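(* Let $L\ge1$ and fix integers $0=k_0<k_1<\dots<k_L$. For every $C\ge1$ and every $\kappa\in(0,1)$ there exist $K>1$ and $C'\ge1$, depending only on $C$, $\kappa$ and the exponents, such that the following holds. Let $\Psi(t)=\sum_{j=0}^Ly_jt^{k_j}$ be a real polynomial with $y_0\neq0$ and $y_L=1$ which lies in the tier regime indexed by $(l_1,\dots,l_s)$ with comparability constant $C$ and separation constant $K$. Then $y_{L-L(j)}\neq 0$ for $0\le j\le s$, and the polynomial $\widetilde\Psi=\prod_{j=1}^s\widetilde\Psi_j$, where $$\widetilde\Psi_j(t)=\frac1{y_{L-L(j-1)}}\sum_{i=0}^{l_j}y_{L-L(j)+i}\,t^{k_{L-L(j)+i}-k_{L-L(j)}},$$ roughly factorises $\Psi$ in the following sense. (i) For each $j$, the roots $\widetilde{\mathcal{T}}_j$ of $\widetilde\Psi_j$ are all of comparable magnitude, i.e. $|w|\le C'|w'|$ for all $w,w'\in\widetilde{\mathcal{T}}_j$, and for any choice of roots $w_j\in\widetilde{\mathcal{T}}_j$ one has $|w_{j+1}|\le\kappa|w_j|$ for $1\le j<s$. (ii) There is a set $N(\mathcal{R})\subset\mathbb{C}$ covering the set $\mathcal{R}$ of roots of $\Psi$ such that each connected component of $N(\mathcal{R})$ (called a cell) is a ball and contains at most $L$ roots of $\Psi$; and a cell containing exactly $m$ roots of $\Psi$ contains exactly $m$ roots of $\widetilde\Psi$. (iii) For every $t\in\mathbb{C}\setminus N(\mathcal{R})$, $|\Psi(t)-\widetilde\Psi(t)|\le\kappa|\Ps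i(t)|$.
   Context: Roots are complex and counted with multiplicity (multisets). Order the roots of $\Psi$ as $|z_1|\ge|z_2|\ge\dots\ge|z_{k_L}|$. Put $D(j)=k_L-k_{L-j}$ for $0\le j\le L$, and define reference heights $h_j=|z_{D(j-1)+1}|$ for $1\le j\le L$. Given positive integers $l_1,\dots,l_s$ with $l_1+\dots+l_s=L$, put $L(0)=0$ and $L(i)=l_1+\dots+l_i$. $\Psi$ is in the tier regime indexed by $(l_1,\dots,l_s)$ with comparability constant $C$ and separation constant $K$ if $h_i\le Ch_j$ whenever $L(r-1)<i,j\le L(r)$ for some $1\le r\le s$, and $h_{L(r)}\ge Kh_{L(r)+1}$ for $1\le r<s$. *)

(* Defs.v *)
From mathcomp Require Import all_boot all_order all_algebra.
From mathcomp Require Import all_classical all_reals all_analysis.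
From mathcomp Require Import complex.

Set Implicit Arguments.
Unset Strict Implicit.
Unset Printing Implicit Defensive.

Import Order.TTheory GRing.Theory Num.Theory.
Import numFieldNormedType.Exports.

Local Open Scope classical_set_scope.
Local Open Scope ring_scope.
Local Open Scope complex_scope.

Section Defs.
Variable R : realType.

Definition cpoly (p : {poly R}) : {poly R[i]} := map_poly (real_complex R) p.

(* Complex roots listed with multiplicity, by nonincreasing modulus: moduli
   are real elements of R[i], so the order of R[i] is total on them.  Only
   meaningful for p != 0. *)
Definition croots (p : {poly R}) : seq R[i] :=
  sort (fun z w => `|w| <= `|z|) (sval (closed_field_poly_normal (cpoly p))).

Definition nb_roots_in (p : {poly R}) (A : set R[i]) : nat :=
  count (fun z => `[< A z >]) (croots p).

Definition Psi (L : nat) (k : nat -> nat) (y : nat -> R) : {poly R} :=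
  \sum_(0 <= j < L.+1) y j *: 'X^(k j).

Definition Ddeg (L : nat) (k : nat -> nat) (j : nat) : nat :=
  (k L - k (L - j))%N.

(* h_j = |z_{D(j-1)+1}| for 1 <= j <= L; the sequence croots is numbered
   from 0, whereas the roots z_1, z_2, ... are numbered from 1. *)
Definition height (L : nat) (k : nat -> nat) (p : {poly R}) (j : nat) : R[i] :=
  `| (croots p)`_(Ddeg L k j.-1) |.

(* The tuple (l_1, ..., l_s) is a sequence l with s = size l and
   l_j = nth 0 l j.-1; tiers are numbered from 1 below. *)
Definition composition (L : nat) (l : seq nat) : Prop :=
  all (fun m => 0 < m)%N l /\ sumn l = L.

Definition Lsum (l : seq nat) (i : nat) : nat := sumn (take i l).

Definition tier_regime (L : nat) (k : nat -> nat) (l : seq nat) (C K : R)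
    (p : {poly R}) : Prop :=
  (forall r i j : nat, (1 <= r <= size l)%N ->
     (Lsum l r.-1 < i <= Lsum l r)%N -> (Lsum l r.-1 < j <= Lsum l r)%N ->
     height L k p i <= C%:C * height L k p j) /\
  (forall r : nat, (1 <= r < size l)%N ->
     K%:C * height L k p (Lsum l r).+1 <= height L k p (Lsum l r)).

Definition tPsi_fac (L : nat) (k : nat -> nat) (y : nat -> R) (l : seq nat)
    (j : nat) : {poly R} :=
  (y (L - Lsum l j.-1)%N)^-1 *:
    \sum_(0 <= i < (nth 0%N l j.-1).+1)
       y (L - Lsum l j + i)%N *:
         'X^(k (L - Lsum l j + i)%N - k (L - Lsum l j)%N).

Definition tPsi (L : nat) (k : nat -> nat) (y : nat -> R) (l : seq nat) :
    {poly R} :=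
  \prod_(1 <= j < (size l).+1) tPsi_fac L k y l j.

(* The topology of the complex plane is carried by the alias R[i]^o. *)
Definition is_open_ball (A : set R[i]^o) : Prop :=
  exists (c : R[i]^o) (r : R), 0 < r /\ A = ball c r%:C.

End Defs.

(* Main.v *)
(** Scale the roots by the height of a tier: larger roots contribute constants to
    the product of the [X - z], smaller ones powers of [X], so near that scale
    Psi is a monomial times the product over the tier, and slicing out its
    coefficients gives the corresponding factor of the approximate polynomial.
    The heights only record the roots at the positions [D j]; a large gap between
    consecutive moduli makes one product dominate the elementary symmetric
    function, so its coefficient is nonzero and the gap sits at some [D j].
    Hence all roots of a tier are comparable.

    At most L roots lie in a disc of small relative radius: applying
    [L] operators [t d/dt - k_i] to a polynomial with [L + 1] terms isolates each
    coefficient, so the polynomial is controlled by its jet of order L at the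
    centre, while [L + 1] roots near the centre make this jet small.

    A pigeonhole choice of the relative radius makes "being close" an equivalence
    relation on the roots with large empty annuli around the classes.  Growth
    across such an annulus counts the roots inside, and off the cells Psi and its
    approximation are close, so both have the same number of roots per cell. *)

Require Import Defs.
From mathcomp Require Import all_boot all_order all_algebra.
From mathcomp Require Import all_classical all_reals all_analysis.
From mathcomp Require Import complex.
From mathcomp Require Import ring lra zify.
Import Order.TTheory GRing.Theory Num.Theory.
Import numFieldNormedType.Exports.
Local Open Scope classical_set_scope.
Local Open Scope ring_scope.
Local Open Scope complex_scope.

Set Implicit Arguments.
Unset Strict Implicit.

(** * Weighted norms of complex polynomials *)

Section Modulus.
Variable R : realType.
Implicit Types (z w : R[i]) (p q : {poly R[i]}).

Definition cmod z : R := complex.Re `|z|.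

Lemma cmodE z : `|z| = (cmod z)%:C.
Proof. by rewrite /cmod normc_def. Qed.

Lemma cmod_ge0 z : 0 <= cmod z.
Proof. by rewrite -lecR -cmodE normr_ge0. Qed.

Lemma cmod0 : cmod 0 = 0.
Proof. by apply: complexI; rewrite -cmodE normr0 rmorph0. Qed.

Lemma cmod1 : cmod 1 = 1.
Proof. by apply: complexI; rewrite -cmodE normr1 rmorph1. Qed.

Lemma cmod_eq0 z : (cmod z == 0) = (z == 0).
Proof. by rewrite -(normr_eq0 z) cmodE -[0 in RHS]/(0%:C) (inj_eq (@complexI R)). Qed.

Lemma cmod_gt0 z : (0 < cmod z) = (z != 0).
Proof. by rewrite lt_def cmod_ge0 andbT cmod_eq0. Qed.

Lemma cmodM z w : cmod (z * w) = cmod z * cmod w.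
Proof. by apply: complexI; rewrite -cmodE normrM !cmodE rmorphM. Qed.

Lemma cmodN z : cmod (- z) = cmod z.
Proof. by rewrite /cmod normrN. Qed.

Lemma cmodB z w : cmod (z - w) = cmod (w - z).
Proof. by rewrite -cmodN opprB. Qed.

Lemma cmodX z n : cmod (z ^+ n) = cmod z ^+ n.
Proof. by elim: n => [|n IH]; rewrite ?expr0 ?cmod1 // !exprS cmodM IH. Qed.

Lemma cmodD z w : cmod (z + w) <= cmod z + cmod w.
Proof. by rewrite -lecR -cmodE rmorphD /= -!cmodE ler_normD. Qed.

Lemma cmod_real (x : R) : cmod x%:C = `|x|.
Proof. by rewrite /cmod normc_def /= expr0n addr0 sqrtr_sqr. Qed.

Lemma cmod_nat n : cmod n%:R = n%:R.
Proof. by rewrite -[n%:R](rmorph_nat (real_complex R)) cmod_real normr_nat. Qed.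

Lemma cmod_sum (I : Type) (r : seq I) (P : pred I) (F : I -> R[i]) :
  cmod (\sum_(i <- r | P i) F i) <= \sum_(i <- r | P i) cmod (F i).
Proof.
elim/big_rec2: _ => [|i y x _ IH]; first by rewrite cmod0.
by apply: le_trans (cmodD _ _) _; rewrite lerD2l.
Qed.

Lemma cmod_prod (I : Type) (r : seq I) (F : I -> R[i]) :
  cmod (\prod_(i <- r) F i) = \prod_(i <- r) cmod (F i).
Proof.
by elim/big_rec2: _ => [|i y x _ IH]; rewrite ?cmod1 // cmodM IH.
Qed.

Lemma cmod_dist z t w : cmod (z - w) <= cmod (z - t) + cmod (t - w).
Proof. by rewrite -[z - w](subrKA t) cmodD. Qed.

Lemma cmod_split z w : cmod z <= cmod (z - w) + cmod w.
Proof. by rewrite -[z in X in X <= _](subrK w) cmodD. Qed.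

Variable rho : R.
Hypothesis rho0 : 0 <= rho.

(* The weighted norm replaces rescaling [t] by the height of a tier. *)
Definition wnorm p : R := \sum_(i < size p) cmod p`_i * rho ^+ i.

Lemma wnorm_wide p n : (size p <= n)%N ->
  wnorm p = \sum_(i < n) cmod p`_i * rho ^+ i.
Proof.
move=> h; rewrite /wnorm.
rewrite (big_ord_widen n (fun i => cmod p`_i * rho ^+ i) h) big_mkcond.
apply: eq_bigr => i _; case: ltnP => // hi.
by rewrite nth_default // cmod0 mul0r.
Qed.

Lemma wnorm_ge0 p : 0 <= wnorm p.
Proof. by apply: sumr_ge0 => i _; rewrite mulr_ge0 ?cmod_ge0 ?exprn_ge0. Qed.

Lemma wnorm0 : wnorm 0 = 0.
Proof. by rewrite /wnorm size_poly0 big_ord0. Qed.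

Lemma wnormC (c : R[i]) : wnorm c%:P = cmod c.
Proof.
rewrite (@wnorm_wide _ 1) ?size_polyC ?leq_b1 //.
by rewrite big_ord1 coefC expr0 mulr1.
Qed.

Lemma wnormMX p : wnorm (p * 'X) = wnorm p * rho.
Proof.
rewrite (@wnorm_wide _ (size p).+1); last first.
  by have [->|p0] := eqVneq p 0; rewrite ?mul0r ?size_poly0 // size_mulX.
rewrite big_ord_recl coefMX eqxx cmod0 mul0r add0r /wnorm mulr_suml.
by apply: eq_bigr => i _; rewrite coefMX /= exprSr mulrA.
Qed.

Lemma wnormD p q : wnorm (p + q) <= wnorm p + wnorm q.
Proof.
rewrite (wnorm_wide (size_polyD p q)).
rewrite (wnorm_wide (leq_maxl (size p) (size q))).
rewrite (wnorm_wide (leq_maxr (size p) (size q))) -big_split /=.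
apply: ler_sum => i _; rewrite coefD -mulrDl.
by rewrite ler_wpM2r ?exprn_ge0 // cmodD.
Qed.

Lemma wnormN p : wnorm (- p) = wnorm p.
Proof.
by rewrite /wnorm size_polyN; apply: eq_bigr => i _; rewrite coefN cmodN.
Qed.

Lemma wnormZ (c : R[i]) p : wnorm (c *: p) = cmod c * wnorm p.
Proof.
rewrite (wnorm_wide (size_scale_leq c p)) /wnorm mulr_sumr.
by apply: eq_bigr => i _; rewrite coefZ cmodM mulrA.
Qed.

(** Horner induction on [p]. The constant term and the shifted coefficients of [p * 'X + c%:P] do
    not overlap, so the triangle inequality is an equality there and nothing is lost in the
    inductive step. *)
Lemma wnormM p q : wnorm (p * q) <= wnorm p * wnorm q.
Proof.
elim/poly_ind: p => [|p c IH]; first by rewrite mul0r wnorm0 mul0r.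
have -> : wnorm (p * 'X + c%:P) = wnorm p * rho + cmod c.
  rewrite (@wnorm_wide _ (size p).+1); last first.
    by rewrite size_MXaddC; case: ifP.
  rewrite big_ord_recl coefD coefMX coefC eqxx add0r expr0 mulr1 addrC.
  congr (_ + _); rewrite /wnorm mulr_suml; apply: eq_bigr => i _.
  by rewrite coefD coefMX coefC /= addr0 exprSr mulrA.
have -> : (p * 'X + c%:P) * q = (p * q) * 'X + c *: q.
  by rewrite mulrDl mul_polyC mulrAC.
apply: le_trans (wnormD _ _) _; rewrite wnormMX wnormZ mulrDl lerD2r.
by rewrite mulrAC ler_wpM2r.
Qed.

Lemma wnorm_coef p i : cmod p`_i * rho ^+ i <= wnorm p.
Proof.
have [hi|hi] := ltnP i (size p); last first.
  by rewrite nth_default // cmod0 mul0r wnorm_ge0.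
rewrite /wnorm (bigD1 (Ordinal hi)) //= lerDl.
by apply: sumr_ge0 => j _; rewrite mulr_ge0 ?cmod_ge0 ?exprn_ge0.
Qed.

Lemma wnorm_prod (I : eqType) (s : seq I) (p : I -> {poly R[i]}) (M : I -> R) :
  (forall i, i \in s -> wnorm (p i) <= M i) ->
  wnorm (\prod_(i <- s) p i) <= \prod_(i <- s) M i.
Proof.
elim: s => [|i s IH] h; first by rewrite !big_nil -polyC1 wnormC cmod1.
rewrite !big_cons; apply: le_trans (wnormM _ _) _.
apply: ler_pM; rewrite ?wnorm_ge0 ?h ?mem_head //.
by apply: IH => j hj; apply: h; rewrite inE hj orbT.
Qed.

(** The error of a product is bounded by the same expansion that turns [\prod (1 + e) * M i] into
    [\prod M i]. The majorants [M] matter because the norm of a product can be much smaller than the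
    product of the norms. *)
Lemma wnorm_prod_perturb (I : eqType) (s : seq I) (p q : I -> {poly R[i]})
    (M : I -> R) (e : R) : 0 <= e ->
  (forall i, i \in s -> wnorm (q i) <= M i) ->
  (forall i, i \in s -> wnorm (p i - q i) <= e * M i) ->
  wnorm (\prod_(i <- s) p i - \prod_(i <- s) q i)
    <= ((1 + e) ^+ size s - 1) * \prod_(i <- s) M i.
Proof.
move=> e0; elim: s => [|i s IH] hq hpq.
  by rewrite !big_nil subrr wnorm0 expr0 subrr mul0r.
have hq' j : j \in s -> wnorm (q j) <= M j.
  by move=> hj; apply: hq; rewrite inE hj orbT.
have hpq' j : j \in s -> wnorm (p j - q j) <= e * M j.
  by move=> hj; apply: hpq; rewrite inE hj orbT.
have {hq}Hq := hq i (mem_head _ _); have {hpq}Hpq := hpq i (mem_head _ _).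
have {}IH := IH hq' hpq'; rewrite !big_cons.
have M0 : 0 <= \prod_(j <- s) M j.
  by apply: le_trans (wnorm_ge0 _) (wnorm_prod hq').
have Qle := wnorm_prod hq'.
set P := \prod_(j <- s) p j in IH *; set Q := \prod_(j <- s) q j in IH Qle *.
have -> : p i * P - q i * Q = (p i - q i) * (P - Q) + ((p i - q i) * Q + q i * (P - Q)).
  by ring.
apply: le_trans (wnormD _ _) _.
apply: le_trans (lerD (wnormM _ _) (wnormD _ _)) _.
apply: le_trans (lerD (lexx _) (lerD (wnormM _ _) (wnormM _ _))) _.
have Mi0 : 0 <= M i by apply: le_trans Hq; rewrite wnorm_ge0.
have -> : ((1 + e) ^+ size (i :: s) - 1) * (M i * \prod_(j <- s) M j) =
  (e * M i) * (((1 + e) ^+ size s - 1) * \prod_(j <- s) M j) +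
  ((e * M i) * \prod_(j <- s) M j
   + M i * (((1 + e) ^+ size s - 1) * \prod_(j <- s) M j)).
  by rewrite /= exprS; ring.
by apply: lerD; [|apply: lerD]; apply: ler_pM; rewrite ?wnorm_ge0.
Qed.

End Modulus.

(** Convexity: for [d] between 0 and 1 the power lies below its chord, of slope [2 ^+ n - 1]. The
    induction runs on this sharper bound. *)
Lemma expr1D_sub1_le (R : realType) (d : R) n : 0 <= d <= 1 ->
  (1 + d) ^+ n - 1 <= 2 ^+ n * d.
Proof.
move=> /andP[d0 d1].
suff H : (1 + d) ^+ n - 1 <= (2 ^+ n - 1) * d.
  by apply: le_trans H _; rewrite ler_wpM2r // lerBlDr lerDl.
elim: n => [|n IH]; first by rewrite !expr0 subrr mul0r.
have h2 : 1 <= 2 ^+ n :> R by rewrite exprn_ege1 // ler1n.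
rewrite !exprS; move: IH h2; set E := (1 + d) ^+ n; set P := 2 ^+ n => IH h2.
have h3 : 0 <= (P - 1) * (d * (1 - d)) by rewrite !mulr_ge0 ?subr_ge0.
have h4 : 0 <= (1 + d) * ((P - 1) * d - (E - 1)).
  by rewrite mulr_ge0 ?subr_ge0 ?addr_ge0.
nra.
Qed.

(** The scalar case, obtained from constant polynomials, on which [wnorm] is multiplicative. *)
Lemma cmod_prod_perturb (R : realType) (I : eqType) (s : seq I)
    (f g : I -> R[i]) (e : R) : 0 <= e ->
  (forall i, i \in s -> cmod (f i - g i) <= e * cmod (g i)) ->
  cmod (\prod_(i <- s) f i - \prod_(i <- s) g i)
    <= ((1 + e) ^+ size s - 1) * cmod (\prod_(i <- s) g i).
Proof.
move=> e0 h; have := @wnorm_prod_perturb R 1 ler01 I s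
  (fun i => (f i)%:P) (fun i => (g i)%:P) (fun i => cmod (g i)) e e0.
rewrite -!rmorph_prod -polyCB wnormC -cmod_prod; apply.
  by move=> i _; rewrite wnormC.
by move=> i hi; rewrite -polyCB wnormC h.
Qed.

(* To be used with [tau = max H |t|]. *)
Lemma cmod_horner_le (R : realType) (q : {poly R[i]}) (d : nat) (B H tau : R)
    (t : R[i]) :
  (size q <= d.+1)%N -> 0 <= B -> 0 <= H <= tau -> cmod t <= tau ->
  (forall e, (e <= d)%N -> cmod q`_e <= B * H ^+ (d - e)) ->
  cmod q.[t] <= d.+1%:R * B * tau ^+ d.
Proof.
move=> sq B0 /andP[H0 Ht] tt hq; rewrite (horner_coef_wide _ sq).
apply: le_trans (cmod_sum _ _ _) _.
have -> : d.+1%:R * B * tau ^+ d = \sum_(i < d.+1) B * tau ^+ d.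
  by rewrite sumr_const card_ord -mulrA mulr_natl.
apply: ler_sum => i _; rewrite cmodM cmodX.
have id' : (i <= d)%N by rewrite -ltnS.
have t0 : 0 <= tau by apply: le_trans Ht.
rewrite -[in tau ^+ d](subnK id') exprD mulrA.
apply: ler_pM; rewrite ?cmod_ge0 ?exprn_ge0 ?cmod_ge0 //.
  apply: le_trans (hq _ id') _.
  by rewrite ler_wpM2l // lerXn2r.
by rewrite lerXn2r ?nnegrE ?cmod_ge0.
Qed.

(** * Clusters of roots of fewnomials *)

Section Cluster.
Variable R : realType.
Implicit Types (F Q : {poly R[i]}) (s : seq R[i]).

(* The operator [t d/dt - a] in the variable [X = t - c]. *)
Definition shifted_euler (c : R[i]) (a : nat) F : {poly R[i]} :=
  ('X + c%:P) * F^`() - a%:R *: F.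

(** Powers of ['X + c%:P] are eigenvectors with eigenvalue [n - a]; the operator with [a = n] kills
    the term of exponent [n]. *)
Lemma shifted_euler_exp c a n (y : R[i]) :
  shifted_euler c a (y *: ('X + c%:P) ^+ n)
    = (y * (n%:R - a%:R)) *: ('X + c%:P) ^+ n.
Proof.
rewrite /shifted_euler derivZ deriv_exp derivD derivX derivC addr0 mul1r.
rewrite -scalerAr.
have -> : ('X + c%:P) * (('X + c%:P) ^+ n.-1 *+ n) = n%:R *: ('X + c%:P) ^+ n.
  case: n => [|n]; first by rewrite mulr0n mulr0 scale0r.
  by rewrite mulrnAr -exprS scaler_nat.
by rewrite !scalerA -scalerBl mulrBr [a%:R * y]mulrC.
Qed.

Lemma shifted_eulerD c a : {morph shifted_euler c a : F Q / F + Q >-> F + Q}.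
Proof.
by move=> F Q; rewrite /shifted_euler derivD mulrDr scalerDr; ring.
Qed.

Lemma shifted_euler_sum c a (I : Type) (r : seq I) (G : I -> {poly R[i]}) :
  shifted_euler c a (\sum_(i <- r) G i) = \sum_(i <- r) shifted_euler c a (G i).
Proof.
elim: r => [|i r IH]; last by rewrite !big_cons shifted_eulerD IH.
by rewrite !big_nil /shifted_euler deriv0 mulr0 scaler0 subr0.
Qed.

Lemma coef_shifted_euler c a F i :
  (shifted_euler c a F)`_i
    = (i%:R - a%:R) * F`_i + c * (i.+1%:R * F`_i.+1).
Proof.
rewrite /shifted_euler coefB coefZ mulrDl coefD coefXM coefCM !coef_deriv.
rewrite -[F`_i.+1 *+ _]mulr_natl; case: i => [|i] /=; first by ring.
by rewrite -[F`_i.+1 *+ _]mulr_natl; ring.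
Qed.

Lemma foldr_shifted_euler c (t : seq nat) (y : nat -> R[i]) (k : nat -> nat) n :
  foldr (shifted_euler c) (\sum_(j < n) y j *: ('X + c%:P) ^+ k j) t
    = \sum_(j < n) (y j * \prod_(a <- t) ((k j)%:R - a%:R))
                     *: ('X + c%:P) ^+ k j.
Proof.
elim: t => [|a t IH] /=.
  by apply: eq_bigr => j _; rewrite big_nil mulr1.
rewrite IH shifted_euler_sum; apply: eq_bigr => j _.
by rewrite shifted_euler_exp big_cons; congr (_ *: _); ring.
Qed.

(** Coefficient [i] of the image uses only the coefficients [i] and [i.+1], so each operator costs
    one more coefficient of [F]. The weight [cmod c ^+ i] absorbs the factor [c], and the
    multipliers add up to [i + a + i.+1], at most [3 * n + 1]. *)
Lemma foldr_shifted_euler_low c (t : seq nat) F n m (B : R) :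
  (m + size t <= n)%N -> all (fun a => a <= n)%N t ->
  (forall i, (i <= m + size t)%N -> cmod F`_i * cmod c ^+ i <= B) ->
  forall i, (i <= m)%N ->
    cmod (foldr (shifted_euler c) F t)`_i * cmod c ^+ i
      <= (3 * n + 1)%:R ^+ size t * B.
Proof.
elim: t m => [|a t IH] m /=.
  by rewrite addn0 => _ _ h i hi; rewrite expr0 mul1r h.
rewrite addnS => hm /andP[ha ht] h i hi.
have {}IH := IH m.+1 hm ht h.
have B1 := IH i (leqW hi); have B2 := IH i.+1 hi.
set G := foldr _ _ _ in B1 B2 *; set b := _ * B in B1 B2.
rewrite coef_shifted_euler exprSr -mulrA [X in _ <= X]mulrC -mulrA -/b.
rewrite [B * _]mulrC -/b.
have b0 : 0 <= b by apply: le_trans B1; rewrite mulr_ge0 ?exprn_ge0 ?cmod_ge0.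
have h1 : cmod (i%:R - a%:R : R[i]) <= i%:R + a%:R.
  by apply: le_trans (cmodD _ _) _; rewrite cmodN !cmod_nat.
have hin : (i.+1 <= n)%N by lia.
apply: (@le_trans _ _ ((i%:R + a%:R) * b + i.+1%:R * b)).
  apply: le_trans (ler_wpM2r (exprn_ge0 _ (cmod_ge0 _)) (cmodD _ _)) _.
  rewrite !cmodM cmod_nat mulrDl; apply: lerD.
    by rewrite -mulrA; apply: ler_pM; rewrite ?mulr_ge0 ?cmod_ge0 ?exprn_ge0 ?cmod_ge0.
  have -> : cmod c * (i.+1%:R * cmod G`_i.+1) * cmod c ^+ i
    = i.+1%:R * (cmod G`_i.+1 * cmod c ^+ i.+1) by rewrite exprS; ring.
  by rewrite ler_wpM2l.
rewrite -mulrDl -!natrD ler_wpM2r // ler_nat; lia.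
Qed.

(* Applying the operators of all the other exponents leaves only the j-th term. *)
Lemma fewnomial_coef_le c (L : nat) (k : nat -> nat) (y : nat -> R[i]) (B : R) :
  (forall i j : nat, (i < j <= L)%N -> (k i < k j)%N) ->
  (forall i, (i <= L)%N ->
     cmod (\sum_(j < L.+1) y j *: ('X + c%:P) ^+ k j)`_i * cmod c ^+ i <= B) ->
  forall j, (j <= L)%N ->
    cmod (y j) * cmod c ^+ k j <= (3 * k L + 1)%:R ^+ L * B.
Proof.
move=> hk hB j hj.
have kle i i' : (i <= i' <= L)%N -> (k i <= k i')%N.
  move=> /andP[h1 h2]; have [->//|ne] := eqVneq i i'.
  by apply: ltnW; apply: hk; rewrite ltn_neqAle ne h1.
have kL i : (i <= L)%N -> (i <= k i)%N.
  elim: i => // i IH hi; apply: leq_ltn_trans (IH (ltnW hi)) _.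
  by apply: hk; rewrite ltnSn.
set t := [seq k i | i <- rem j (iota 0 L.+1)].
have jt : j \in iota 0 L.+1 by rewrite mem_iota add0n ltnS hj.
have memt i : (i \in rem j (iota 0 L.+1)) = (i != j) && (i <= L)%N.
  by rewrite mem_rem_uniq ?iota_uniq // inE mem_iota add0n ltnS.
have st : size t = L by rewrite size_map size_rem // size_iota.
have at' : all (fun a => a <= k L)%N t.
  rewrite all_map; apply/allP => i; rewrite memt => /andP[_ hi] /=.
  by apply: kle; rewrite hi leqnn.
have := @foldr_shifted_euler_low c t (\sum_(j < L.+1) y j *: ('X + c%:P) ^+ k j)
  (k L) 0 B; rewrite st add0n => /(_ (kL _ (leqnn _)) at' hB 0%N (leqnn _)).
rewrite foldr_shifted_euler expr0 mulr1 (bigD1 (Ordinal (hj : (j < L.+1)%N))) //=.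
rewrite [\sum_(i < L.+1 | _) _]big1 ?addr0; last first.
  move=> i ne; rewrite (big_rem (k i)) /= ?subrr ?mul0r ?mulr0 ?scale0r //.
  apply: map_f; rewrite memt -ltnS ltn_ord andbT.
  by apply: contra ne => /eqP e; apply/eqP/val_inj.
move=> H; apply: le_trans H; rewrite coefZ.
have -> : (('X + c%:P) ^+ k j)`_0 = c ^+ k j.
  by rewrite -horner_coef0 horner_exp hornerD hornerX hornerC add0r.
rewrite !cmodM cmodX mulrAC ler_peMr ?mulr_ge0 ?exprn_ge0 ?cmod_ge0 //.
rewrite cmod_prod big_map big_seq.
apply: (big_ind (fun x : R => 1 <= x)) => // [x y' hx hy|i].
  by rewrite -[1]mulr1 ler_pM.
rewrite memt => /andP[ne hi].
have [lt|gt|e] := ltngtP i j; last by rewrite e eqxx in ne.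
- have := hk i j; rewrite lt hj => /(_ isT) h.
  by rewrite -natrB 1?ltnW // cmod_nat ler1n subn_gt0.
- have := hk j i; rewrite gt hi => /(_ isT) h.
  by rewrite cmodB -natrB 1?ltnW // cmod_nat ler1n subn_gt0.
Qed.

(** A converse to [wnormM]. From [Q * 'X = Q * ('X - u%:P) + u *: Q] and [cmod u <= rho / 2], the
    last term is at most half of the left side, so each division by such a factor costs
    [2 / rho]. *)
Lemma wnorm_divXsub (rho : R) Q s : 0 <= rho ->
  (forall u, u \in s -> cmod u <= rho / 2) ->
  wnorm rho Q * rho ^+ size s
    <= 2 ^+ size s * wnorm rho (Q * \prod_(u <- s) ('X - u%:P)).
Proof.
move=> r0; elim: s Q => [|u s IH] Q h.
  by rewrite big_nil mulr1 !expr0 mulr1 mul1r.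
have hu := h u (mem_head _ _).
have {IH}h2 : wnorm rho (Q * ('X - u%:P)) * rho ^+ size s
    <= 2 ^+ size s * wnorm rho (Q * ('X - u%:P) * \prod_(u <- s) ('X - u%:P)).
  by apply: IH => v hv; apply: h; rewrite inE hv orbT.
rewrite big_cons mulrA /= !exprS -mulrA mulrA.
have h1 : wnorm rho Q * rho <= 2 * wnorm rho (Q * ('X - u%:P)).
  rewrite -wnormMX //.
  have e : Q * 'X = Q * ('X - u%:P) + u *: Q by rewrite -mul_polyC; ring.
  have := wnormD r0 (Q * ('X - u%:P)) (u *: Q); rewrite -e wnormZ wnormMX //.
  have := ler_wpM2r (wnorm_ge0 r0 Q) hu; lra.
apply: le_trans (ler_wpM2r (exprn_ge0 _ r0) h1) _.
by rewrite -!mulrA ler_pM2l ?mulrA // ltr0n.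
Qed.

(** The factors with roots near 0 are nearly ['X], so [F] is nearly [Q * 'X^(size s)], which has no
    coefficient below [size s]. One factor [2 ^+ size s] comes from the perturbation of the product,
    the other from recovering [Q] out of [F]. *)
Lemma wnorm_low_coef (c : R[i]) (e : R) Q s m :
  0 <= e <= 2^-1 -> (m < size s)%N ->
  (forall u, u \in s -> cmod u <= e * cmod c) ->
  forall F, F = Q * \prod_(u <- s) ('X - u%:P) ->
  cmod F`_m * cmod c ^+ m <= 4 ^+ size s * e * wnorm (cmod c) F.
Proof.
move=> /andP[e0 e1] hm hs F EF; have r0 := cmod_ge0 c.
set rho := cmod c in r0 hs *.
have W : wnorm rho (\prod_(u <- s) ('X - u%:P) - 'X^(size s))
    <= ((1 + e) ^+ size s - 1) * rho ^+ size s.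
  have := @wnorm_prod_perturb R rho r0 _ s (fun u => 'X - u%:P)
    (fun _ => 'X) (fun _ => rho) e e0.
  rewrite !big_const_seq count_predT !iter_mulr_1; apply.
    move=> u _; rewrite -[X in wnorm _ X]mul1r wnormMX // -polyC1 wnormC cmod1.
    by rewrite mul1r.
  by move=> u hu; rewrite addrAC subrr add0r wnormN wnormC hs.
have -> : F`_m = (Q * (\prod_(u <- s) ('X - u%:P) - 'X^(size s)))`_m.
  by rewrite EF mulrBr coefB coefMXn hm subr0.
apply: le_trans (wnorm_coef r0 _ _) _.
apply: le_trans (wnormM r0 _ _) _.
apply: le_trans (ler_wpM2l (wnorm_ge0 r0 _) W) _.
rewrite mulrCA.
have h2 : wnorm rho Q * rho ^+ size s <= 2 ^+ size s * wnorm rho F.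
  rewrite EF; apply: wnorm_divXsub => // u hu; apply: le_trans (hs u hu) _.
  by rewrite mulrC ler_wpM2l.
have h3 : (1 + e) ^+ size s - 1 <= 2 ^+ size s * e.
  by apply: expr1D_sub1_le; rewrite e0; lra.
have -> : 4 ^+ size s * e * wnorm rho F
   = (2 ^+ size s * e) * (2 ^+ size s * wnorm rho F).
  have -> : (4 : R) = 2 * 2 by ring.
  by rewrite exprMn; ring.
apply: ler_pM => //; last by rewrite mulr_ge0 ?wnorm_ge0 ?exprn_ge0.
by rewrite subr_ge0 exprn_ege1 // lerDl.
Qed.

Lemma wnorm_fewnomial_le (c : R[i]) (L n : nat) (k : nat -> nat)
    (y : nat -> R[i]) : (forall j, (j <= L)%N -> (k j <= n)%N) ->
  wnorm (cmod c) (\sum_(j < L.+1) y j *: ('X + c%:P) ^+ k j)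
    <= 2 ^+ n * \sum_(j < L.+1) cmod (y j) * cmod c ^+ k j.
Proof.
move=> hn; have r0 := cmod_ge0 c; set rho := cmod c in r0 *.
have hX m : wnorm rho (('X + c%:P) ^+ m) <= (2 * rho) ^+ m.
  elim: m => [|m IH]; first by rewrite !expr0 -polyC1 wnormC cmod1.
  rewrite !exprS; apply: le_trans (wnormM r0 _ _) _.
  apply: ler_pM; rewrite ?wnorm_ge0 //.
  apply: le_trans (wnormD r0 _ _) _; rewrite wnormC -[X in wnorm _ X]mul1r.
  by rewrite wnormMX // -polyC1 wnormC cmod1 mul1r mulr_natl mulr2n.
rewrite mulr_sumr.
elim/big_ind2: _ => [|F a G b hF hG|j _]; first by rewrite wnorm0.
  by apply: le_trans (wnormD r0 _ _) _; apply: lerD.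
rewrite wnormZ; apply: le_trans (ler_wpM2l (cmod_ge0 _) (hX _)) _.
rewrite exprMn mulrCA ler_wpM2r ?mulr_ge0 ?exprn_ge0 ?cmod_ge0 //.
by rewrite ler_weXn2l ?ler1n // hn // -ltnS.
Qed.

(** With more than [L] roots near [c], the Taylor coefficients at [c] up to order [L] are small
    compared with the sum of the [cmod (y j) * cmod c ^+ k j], whereas by [fewnomial_coef_le] they
    control every term of that sum. *)
Lemma fewnomial_cluster (L : nat) (k : nat -> nat) :
  (forall i j : nat, (i < j <= L)%N -> (k i < k j)%N) ->
  exists e : R, 0 < e <= 2^-1 /\
    forall (y : nat -> R[i]) s (c : R[i]),
      \sum_(j < L.+1) y j *: 'X^(k j) = \prod_(z <- s) ('X - z%:P) ->
      c != 0 -> (count (fun z => cmod (z - c) < e * cmod c)%R s <= L)%N.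
Proof.
move=> hk; pose n := k L.
(* The factors come from the [L.+1] summands, [fewnomial_coef_le], [wnorm_low_coef] and
   [wnorm_fewnomial_le] in turn. The radius [(2 * A)^-1] makes the total factor one half. *)
pose A : R := L.+1%:R * ((3 * n + 1)%:R ^+ L * (4 ^+ n * 2 ^+ n)).
have A1 : 1 <= A.
  have h a b : 1 <= a -> 1 <= b -> 1 <= a * b :> R.
    by move=> ha hb; rewrite -[1]mulr1 ler_pM.
  by rewrite !h ?exprn_ege1 ?ler1n // addn1.
exists (2 * A)^-1; split.
  rewrite invr_gt0 lef_pV2 ?posrE ?mulr_gt0 ?(lt_le_trans ltr01 A1) //=.
  by rewrite ler_peMr.
move=> y s c hs c0; set e := (2 * A)^-1.
have eA : e * A = 2^-1 by rewrite /e invfM mulfVK // gt_eqF // (lt_le_trans ltr01).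
have e0 : 0 <= e <= 2^-1.
  rewrite invr_ge0 mulr_ge0 ?(le_trans ler01 A1) //= lef_pV2 ?posrE //.
    by rewrite ler_peMr.
  by rewrite mulr_gt0 ?(lt_le_trans ltr01 A1).
have hn j : (j <= L)%N -> (k j <= n)%N.
  move=> hj; have [->//|ne] := eqVneq j L.
  by apply: ltnW; apply: hk; rewrite ltn_neqAle ne hj leqnn.
rewrite leqNgt; apply/negP => hc.
set a : pred R[i] := (fun z => _) in hc.
(* In the variable centred at [c], [t] lists the near roots and [Q] collects the others. *)
pose t := [seq z - c | z <- seq.filter a s].
pose Q := \prod_(z <- seq.filter (predC a) s) ('X - (z - c)%:P).
have st : size t = count a s by rewrite size_map size_filter.
have tn : (size t <= n)%N.
  rewrite st; apply: leq_trans (count_size _ _) _.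
  rewrite -ltnS -(size_prod_XsubC s id) -hs.
  apply: leq_trans (size_sum _ _ _) _; apply/bigmax_leqP => j _.
  apply: leq_trans (size_scale_leq _ _) _; rewrite size_polyXn ltnS hn //.
  by rewrite -ltnS.
pose F := \sum_(j < L.+1) y j *: ('X + c%:P) ^+ k j.
have EF : F = Q * \prod_(u <- t) ('X - u%:P).
  have -> : F = (\sum_(j < L.+1) y j *: 'X^(k j)) \Po ('X + c%:P).
    rewrite raddf_sum; apply: eq_bigr => j _ /=.
    by rewrite comp_polyZ rmorphXn /= comp_polyX.
  rewrite hs rmorph_prod /= /t big_map /Q mulrC -big_cat /=.
  rewrite -(perm_big _ (permEl (perm_filterC a s))) /=.
  by apply: eq_bigr => z _; rewrite comp_polyB comp_polyX comp_polyC polyCB; ring.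
pose S := \sum_(j < L.+1) cmod (y j) * cmod c ^+ k j.
have S0 : 0 <= S.
  by apply: sumr_ge0 => j _; rewrite mulr_ge0 ?exprn_ge0 ?cmod_ge0.
have low i : (i <= L)%N -> cmod F`_i * cmod c ^+ i <= 4 ^+ n * e * (2 ^+ n * S).
  move=> hi.
  have := @wnorm_low_coef c e Q t i e0; rewrite st => H.
  have {}H : cmod F`_i * cmod c ^+ i <= 4 ^+ count a s * e * wnorm (cmod c) F.
    apply: H; first exact: leq_ltn_trans hc.
      by move=> u /mapP[z]; rewrite mem_filter => /andP[/ltW hz _] ->.
    exact: EF.
  apply: le_trans H _; apply: ler_pM.
  - by rewrite mulr_ge0 ?exprn_ge0 // (andP e0).1.
  - by rewrite wnorm_ge0 ?cmod_ge0.
  - rewrite ler_wpM2r ?(andP e0).1 // ler_weXn2l ?ler1n // -st //.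
  - exact: wnorm_fewnomial_le.
have hy := fewnomial_coef_le hk low.
(* This forces [S = 0]; as [c] is nonzero, every [y j] vanishes, which is impossible for a monic
   polynomial. *)
have : S <= 2^-1 * S.
  apply: (@le_trans _ _
    (\sum_(j < L.+1) ((3 * k L + 1)%:R ^+ L * (4 ^+ n * e * (2 ^+ n * S))))).
    by apply: ler_sum => j _; apply: hy; rewrite -ltnS.
  rewrite sumr_const card_ord -[X in X <= _]mulr_natl -eA /A -/n.
  by rewrite le_eqVlt; apply/orP; left; apply/eqP; ring.
move=> hS; have {hS S0} S0 : S = 0 by apply/eqP; rewrite eq_le S0 andbT; lra.
have /eqP := S0; rewrite psumr_eq0 => [/allP hz|j _]; last first.
  by rewrite mulr_ge0 ?exprn_ge0 ?cmod_ge0.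
have : \prod_(z <- s) ('X - z%:P) = 0 :> {poly R[i]}.
  rewrite -hs big1 // => j _; have := hz j (mem_index_enum _).
  rewrite mulf_eq0 cmod_eq0 expf_eq0 cmod_eq0 (negPf c0) andbF orbF.
  by move=> /eqP ->; rewrite scale0r.
by apply/eqP; exact: monic_neq0 (monic_prod_XsubC _ _ _).
Qed.
End Cluster.

(** * Counting roots by growth *)

Section Count.
Variable R : realType.
Implicit Types (s : seq R[i]) (c z t : R[i]).

(** Between the two test points on a ray from [c], the distance to a root near [c] is multiplied by
    about [A], and the distance to a far root stays about the same; both hold up to a factor 4. *)
Lemma growth_factor (A r : R) c z : 2 <= A -> 0 < r ->
  let d := cmod (z - c) in
  let f1 := cmod (c + (A * r)%:C - z) in
  let f2 := cmod (c + (A ^+ 2 * r)%:C - z) in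
  (d < r -> f2 <= 4 * A * f1 /\ A * f1 <= 4 * f2) /\
  (2 * (A ^+ 2 * r) <= d -> f2 <= 4 * f1 /\ f1 <= 4 * f2).
Proof.
move=> A2 r0 d f1 f2.
have up (x : R) : 0 <= x -> cmod (c + x%:C - z) <= x + d /\
    x <= cmod (c + x%:C - z) + d /\ d <= cmod (c + x%:C - z) + x.
  move=> x0; have hx : cmod x%:C = x by rewrite cmod_real ger0_norm.
  split; [|split].
  - have -> : c + x%:C - z = x%:C + (c - z) by ring.
    by apply: le_trans (cmodD _ _) _; rewrite hx [d]cmodB.
  - rewrite -{1}hx; have {1}-> : x%:C = (c + x%:C - z) + (z - c) by ring.
    exact: cmodD.
  - rewrite -{2}hx [d]cmodB; have -> : c - z = (c + x%:C - z) + - x%:C by ring.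
    by apply: le_trans (cmodD _ _) _; rewrite cmodN.
have Ar0 : 0 <= A * r by rewrite mulr_ge0 ?ltW //; lra.
have AAr0 : 0 <= A ^+ 2 * r by apply: mulr_ge0; [apply: exprn_ge0; lra|exact: ltW].
have [u1 [l1 k1]] := up _ Ar0; have [u2 [l2 k2]] := up _ AAr0.
have h1 : 2 * r <= A * r by rewrite ler_pM2r.
have h2 : 2 * (A * r) <= A ^+ 2 * r by rewrite expr2 -mulrA ler_pM2r // ; nra.
rewrite -/f1 -/f2 in u1 l1 k1 u2 l2 k2; split=> hd; last by split; lra.
have f1h : A * r / 2 <= f1 by lra.
have f2h : A ^+ 2 * r / 2 <= f2 by lra.
split.
  apply: (@le_trans _ _ (4 * A * (A * r / 2))); last first.
    by rewrite ler_wpM2l // mulr_ge0 //; lra.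
  have -> : 4 * A * (A * r / 2) = 2 * (A ^+ 2 * r) by field.
  lra.
apply: (@le_trans _ _ (A * (2 * (A * r)))).
  by rewrite ler_wpM2l //; lra.
have -> : A * (2 * (A * r)) = 2 * (A ^+ 2 * r) by ring.
lra.
Qed.

Lemma growth_prod (A r : R) c s : 2 <= A -> 0 < r ->
  (forall z, z \in s -> cmod (z - c) < r \/ 2 * (A ^+ 2 * r) <= cmod (z - c)) ->
  let m := count (fun z => cmod (z - c) < r) s in
  let f1 := cmod (\prod_(z <- s) (c + (A * r)%:C - z)) in
  let f2 := cmod (\prod_(z <- s) (c + (A ^+ 2 * r)%:C - z)) in
  f2 <= 4 ^+ size s * A ^+ m * f1 /\ A ^+ m * f1 <= 4 ^+ size s * f2.
Proof.
move=> A2 r0; elim: s => [|z s IH] h /=.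
  by rewrite !big_nil !expr0 cmod1 !mulr1.
have /IH : forall w, w \in s ->
    cmod (w - c) < r \/ 2 * (A ^+ 2 * r) <= cmod (w - c).
  by move=> w hw; apply: h; rewrite inE hw orbT.
rewrite !big_cons !cmodM.
set m := count _ _; set f1 := cmod (\prod_(_ <- _) _).
set f2 := cmod (\prod_(_ <- _) _) => /= -[i1 i2].
have := growth_factor c z A2 r0; rewrite /=.
set g1 := cmod (c + (A * r)%:C - z).
set g2 := cmod (c + (A ^+ 2 * r)%:C - z); move=> [hin hout].
have f10 : 0 <= f1 by exact: cmod_ge0.
have f20 : 0 <= f2 by exact: cmod_ge0.
have g10 : 0 <= g1 by exact: cmod_ge0.
have g20 : 0 <= g2 by exact: cmod_ge0.
have A0 : 0 <= A by lra.
have P0 k : 0 <= A ^+ k by rewrite exprn_ge0.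
have Q0 k : 0 <= 4 ^+ k :> R by rewrite exprn_ge0.
have [hr|hr] := ltP (cmod (z - c)) r; rewrite ?add1n ?add0n !exprS.
  have [j1 j2] := hin hr; split.
    by have := ler_pM g20 f20 j1 i1; congr (_ <= _); ring.
  by have := ler_pM (mulr_ge0 A0 g10) (mulr_ge0 (P0 m) f10) j2 i2;
    congr (_ <= _); ring.
have [|hd] := h z (mem_head _ _); first by rewrite ltNge hr.
have [j1 j2] := hout hd; split.
  by have := ler_pM g20 f20 j1 i1; congr (_ <= _); ring.
by have := ler_pM g10 (mulr_ge0 (P0 m) f10) j2 i2; congr (_ <= _); ring.
Qed.

(** The choice of [A] makes one extra factor [A] exceed the total loss [3 * 16 ^+ n] of the
    comparisons, so the growth rate determines the integer exponent. *)
Lemma growth_exponent_le (n m m' : nat) (f2 g1 g2 : R) :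
  let A := 4 * 16 ^+ n in
  0 < g1 -> A ^+ m' * g1 <= 4 ^+ n * g2 -> g2 <= 2 * f2 ->
  2 * f2 <= 3 * (4 ^+ n * A ^+ m * g1) -> (m' <= m)%N.
Proof.
move=> A g10 h1 h2 h3; rewrite leqNgt; apply/negP => lt.
have n16 : 1 <= 16 ^+ n :> R by rewrite exprn_ege1 // ler1n.
have A1 : 1 <= A by rewrite /A; lra.
have : 4 * 16 ^+ n * A ^+ m * g1 <= 3 * 16 ^+ n * A ^+ m * g1.
  apply: (@le_trans _ _ (A ^+ m' * g1)).
    by rewrite -/A -exprS ler_pM2r // ler_weXn2l.
  apply: le_trans h1 _; apply: (@le_trans _ _ (4 ^+ n * (3 * (4 ^+ n * A ^+ m * g1)))).
    by rewrite ler_wpM2l ?exprn_ge0 // (le_trans h2).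
  have -> : 16 ^+ n = 4 ^+ n * 4 ^+ n :> R.
    by rewrite -exprMn; congr (_ ^+ _); ring.
  by rewrite le_eqVlt; apply/orP; left; apply/eqP; ring.
rewrite -!mulrA; have : 0 < 16 ^+ n * (A ^+ m * g1).
  by rewrite !mulr_gt0 ?exprn_gt0 //; lra.
lra.
Qed.

(* A substitute for Rouche's theorem: a polynomial of degree at most [n] with [m]
   roots inside a disc and all the others far away grows like [A ^ m] between the
   radii [A r] and [A ^ 2 r], so comparable polynomials have the same [m]. *)
Lemma count_roots_eq (n : nat) (r : R) c s s' (a : R[i]) :
  let A := 4 * 16 ^+ n in
  let far z := cmod (z - c) < r \/ 2 * (A ^+ 2 * r) <= cmod (z - c) in
  0 < r -> (size s <= n)%N -> (size s' <= n)%N ->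
  (forall z, z \in s -> far z) -> (forall z, z \in s' -> far z) ->
  (forall t, t = c + (A * r)%:C \/ t = c + (A ^+ 2 * r)%:C ->
     2 * cmod (\prod_(z <- s) (t - z) - a * \prod_(z <- s') (t - z))
       <= cmod (\prod_(z <- s) (t - z))) ->
  count (fun z => cmod (z - c) < r) s = count (fun z => cmod (z - c) < r) s'.
Proof.
move=> A far r0 sn sn' hs hs' hfg.
have n16 : 1 <= 16 ^+ n :> R by rewrite exprn_ege1 // ler1n.
have A2 : 2 <= A by rewrite /A; lra.
have [p1 p2] := growth_prod A2 r0 hs; have [q1 q2] := growth_prod A2 r0 hs'.
have := hfg _ (or_introl erefl); have := hfg _ (or_intror erefl).
rewrite -/A in p1 p2 q1 q2 *.
set F1 := \prod_(z <- s) (c + (A * r)%:C - z) in p1 p2 *.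
set F2 := \prod_(z <- s) (c + (A ^+ 2 * r)%:C - z) in p1 p2 *.
set G1 := \prod_(z <- s') (c + (A * r)%:C - z) in q1 q2 *.
set G2 := \prod_(z <- s') (c + (A ^+ 2 * r)%:C - z) in q1 q2 *.
set m := count _ s in p1 p2 *; set m' := count _ s' in q1 q2 *.
move=> e2 e1.
have c4 k : (k <= n)%N -> 4 ^+ k <= 4 ^+ n :> R.
  by move=> hk; rewrite ler_weXn2l // ler1n.
have AP k : 0 <= A ^+ k by rewrite exprn_ge0 //; lra.
have {}p1 : cmod F2 <= 4 ^+ n * A ^+ m * cmod F1.
  by apply: le_trans p1 _; rewrite -!mulrA ler_wpM2r ?c4 // mulr_ge0 ?cmod_ge0.
have {}p2 : A ^+ m * cmod F1 <= 4 ^+ n * cmod F2.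
  by apply: le_trans p2 _; rewrite ler_wpM2r ?c4 ?cmod_ge0.
have {}q1 : cmod (a * G2) <= 4 ^+ n * A ^+ m' * cmod (a * G1).
  rewrite !cmodM mulrCA ler_wpM2l ?cmod_ge0 //.
  by apply: le_trans q1 _; rewrite -!mulrA ler_wpM2r ?c4 // mulr_ge0 ?cmod_ge0.
have {}q2 : A ^+ m' * cmod (a * G1) <= 4 ^+ n * cmod (a * G2).
  rewrite !cmodM ![_ * (cmod a * _)]mulrCA ler_wpM2l ?cmod_ge0 //.
  by apply: le_trans q2 _; rewrite ler_wpM2r ?c4 ?cmod_ge0.
(* A root at this test point would be at distance [A * r] from [c], inside the annulus that [far]
   excludes. *)
have F10 : 0 < cmod F1.
  rewrite cmod_gt0 prodf_seq_neq0; apply/allP => z hz /=; rewrite subr_eq0.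
  apply/eqP => e; have := hs z hz; rewrite -e /far addrAC subrr add0r cmod_real.
  have h1 : r < A * r by rewrite ltr_pMl //; lra.
  rewrite ger0_norm; last by lra.
  have h2 : A * r <= A ^+ 2 * r by rewrite ler_pM2r // expr2; nra.
  by lra.
have b1 := cmod_split F1 (a * G1); have b2 := cmod_split F2 (a * G2).
have d1 := cmod_split (a * G1) F1; have d2 := cmod_split (a * G2) F2.
rewrite cmodB in d1; rewrite cmodB in d2.
have X0 k : 0 <= 4 ^+ n * A ^+ k by apply: mulr_ge0; rewrite ?AP // exprn_ge0.
(* The two inequalities exchange the roles of the products. In the second, [3 / 4 * cmod F2] is
   chosen because [cmod (a * G2)] is at most [3 / 2] times [cmod F2]. *)
apply/eqP; rewrite eqn_leq; apply/andP; split.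
  apply: (@growth_exponent_le n _ _ (cmod (a * G2)) (cmod F1) (cmod F2)) => //=;
    rewrite -/A //.
    by lra.
  have h : 2 * cmod (a * G1) <= 3 * cmod F1 by lra.
  by have := ler_wpM2l (X0 m') h; lra.
have G10 : 0 < cmod (a * G1) by lra.
apply: (@growth_exponent_le n _ _ (3 / 4 * cmod F2) (cmod (a * G1))
  (cmod (a * G2))) => //=; rewrite -/A //.
  by lra.
have h : cmod F1 <= 2 * cmod (a * G1) by lra.
by have := ler_wpM2l (X0 m) h; lra.
Qed.

(** Pigeonhole: if some element lies in the window from [e] to [M * e], discard the elements of that
    window and pass to [e / M]. Discarded elements are at least [e], hence at least [M * sg] for the
    scale found later. *)
Lemma gap_scale (xs : seq R) (M e : R) n : 1 <= M -> 0 < e -> (size xs <= n)%N ->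
  exists sg : R, [/\ e / M ^+ n <= sg, sg <= e &
    forall x, x \in xs -> x < sg \/ M * sg <= x].
Proof.
move=> M1; have M0 : 0 < M by lra.
elim: n xs e => [|n IH] xs e e0.
  rewrite leqn0 size_eq0 => /eqP ->; exists e; split=> //.
  by rewrite expr0 divr1.
move=> hsz; pose I0 x := (e <= x < M * e).
have eM : e / M <= e by rewrite ler_pdivrMr // ler_peMr // ltW.
have [hI|hI] := boolP (has I0 xs); last first.
  exists e; split=> // [|x hx].
    rewrite ler_pdivrMr ?exprn_gt0 //.
    by apply: ler_peMr; [exact: ltW|exact: exprn_ege1].
  move/hasPn: hI => /(_ x hx); rewrite /I0 negb_and -ltNge -leNgt.
  by move=> /orP[]; [left|right].
have [||sg [h1 h2 h3]] := IH [seq x <- xs | ~~ I0 x] (e / M).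
- by rewrite divr_gt0.
- rewrite size_filter -ltnS; apply: leq_trans hsz.
  by rewrite -(count_predC I0 xs) -[X in (X < _)%N]add0n ltn_add2r -has_count.
exists sg; split=> [||x hx].
- by rewrite exprS invfM mulrA.
- exact: le_trans eM.
have [hx0|hx0] := boolP (I0 x).
  right; move/andP: hx0 => [h _]; apply: le_trans h.
  by rewrite mulrC -ler_pdivlMr.
by apply: h3; rewrite mem_filter hx0.
Qed.
End Count.

(** * Components of unions of balls *)

Section Topology.
Variable R : realType.
Implicit Types (z t : R[i]).

Lemma in_ball (z t : R[i]^o) (r : R) :
  ball z r%:C t <-> cmod (z - t : R[i]) < r.
Proof. by rewrite -ball_normE /= cmodE ltcR. Qed.

(** The ball is the union of the segments from its centre, which all share that point. *)
Lemma ball_connected (z : R[i]^o) (r : R) : 0 < r -> connected (ball z r%:C).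
Proof.
move=> r0.
have E : ball z r%:C = \bigcup_(t in ball z r%:C)
    ((fun x : R => (z + x%:C * (t - z) : R[i]^o)) @` `[0, 1]).
  apply/seteqP; split=> [t ht|u [t ht [x]]].
    exists t => //; exists 1; first by rewrite /= in_itv /= ler01 lexx.
    by rewrite mul1r addrC subrK.
  rewrite /= in_itv /= => /andP[x0 x1] <-; apply/in_ball.
  have -> : z - (z + x%:C * (t - z)) = x%:C * (z - t) :> R[i] by ring.
  move/in_ball: ht => ht; rewrite cmodM cmod_real ger0_norm //.
  by apply: le_lt_trans ht; rewrite ler_piMl ?cmod_ge0.
rewrite E; apply: bigcup_connected.
  exists z => t _ /=; exists 0; first by rewrite in_itv /= lexx ler01.
  by rewrite mul0r addr0.
move=> t _; apply: connected_continuous_connected.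
  exact: segment_connected.
apply: continuous_subspaceT => x A /nbhs_ballP[e /= e0 eA].
have eE : e = (complex.Re e)%:C.
  by case: e e0 {eA} => a b; rewrite ltcE /= => /andP[/eqP -> _].
have {}e0 : 0 < complex.Re e by rewrite -ltcR -eE.
have d0 : 0 < cmod (t - z : R[i]) + 1 by rewrite ltr_pwDr ?cmod_ge0.
apply/nbhs_ballP; exists (complex.Re e / (cmod (t - z : R[i]) + 1)) => /=.
  by rewrite divr_gt0.
move=> x' hx; apply: eA; rewrite eE; apply/in_ball.
have -> : z + x%:C * (t - z) - (z + x'%:C * (t - z)) = (x - x')%:C * (t - z) :> R[i].
  by rewrite rmorphB /=; ring.
rewrite cmodM cmod_real; move: hx; rewrite -ball_normE /= ltr_pdivlMr //.
by apply: le_lt_trans; rewrite ler_wpM2l // lerDl.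
Qed.

Lemma component_disjoint_balls (s : seq R[i]) (rad : R[i] -> R) :
  (forall z, z \in s -> 0 < rad z) ->
  (forall z z', z \in s -> z' \in s -> z != z' ->
     rad z + rad z' <= cmod (z - z')) ->
  let N : set R[i]^o := fun t => exists2 z, z \in s & cmod (z - t) < rad z in
  forall z (t : R[i]^o), z \in s -> cmod (z - t : R[i]) < rad z ->
    connected_component N t = (ball (z : R[i]^o) (rad z)%:C : set R[i]^o).
Proof.
move=> r0 hs N z t zs zt.
have disj w u : w \in s -> cmod (w - u) < rad w -> cmod (z - u) < rad z -> w = z.
  move=> ws h1 h2; apply/eqP; apply: contraT => ne.
  have := hs w z ws zs ne; have := cmod_dist w u z; rewrite (cmodB u); lra.
apply/seteqP; split; last first.
  apply: connected_component_max.
  - exact/in_ball.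
  - by move=> u /in_ball hu; exists z.
  - exact/ball_connected/r0.
set B := connected_component N t.
have BN : B `<=` N by exact: connected_component_sub.
have Bt : B t by apply: connected_component_refl; exists z.
have op (w : R[i]^o) : open (ball w (rad w)%:C).
  exact: ball_open.
(* The ball meets the component in a nonempty relatively clopen set, which is therefore the whole
   component. Closedness holds because the complement within [N] is covered by the other open
   balls. *)
suff <- : B `&` ball (z : R[i]^o) (rad z)%:C = B by move=> u [].
apply: (@component_connected _ N t).
- by exists t; split=> //; apply/in_ball.
- by exists (ball (z : R[i]^o) (rad z)%:C); first exact: op.
- exists (~` \bigcup_(w in [set w : R[i]^o | w \in s /\ w != z]) ball w (rad w)%:C).
    by apply: open_closedC; apply: bigcup_open => w _; apply: op.
  apply/seteqP; split=> u [Bu hu]; split=> //.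
    move=> [w [ws wz] /in_ball hw]; move/in_ball: hu => hu.
    by move/eqP: wz; apply; apply: disj hw hu.
  have [w ws hw] := BN u Bu.
  have [wz|wz] := eqVneq w z; first by rewrite wz in hw; apply/in_ball.
  by exfalso; apply: hu; exists w => //; apply/in_ball.
Qed.
End Topology.

(** * Cells *)

Section Cells.
Variable R : realType.
Implicit Types (s : seq R[i]) (c z w t : R[i]).

(** The radius is relative to [cmod z], so symmetry is not built in; it follows on [s] from the gap
    condition [sep]. *)
Definition near_rel (sg : R) z w := cmod (w - z) < sg * cmod z.

(** The first element of [s] close to [z] is a canonical representative of its class. The default 0
    is never reached for [z] in [s], which is close to itself. *)
Definition near_rep (sg : R) s z : R[i] := head 0 [seq w <- s | near_rel sg z w].

Section Separated.
Variables (s : seq R[i]) (M sg : R).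
Hypothesis s0 : forall z, z \in s -> z != 0.
Hypothesis M4 : 4 <= M.
Hypothesis sg0 : 0 < sg.
Hypothesis Msg : M * sg <= 2^-1.
Hypothesis sep : forall z w, z \in s -> w \in s ->
  near_rel sg z w \/ M * (sg * cmod z) <= cmod (w - z).
Local Notation near := (near_rel sg).
Local Notation rep := (near_rep sg s).

Lemma sg_small : sg <= 8^-1.
Proof. have : 4 * sg <= M * sg by rewrite ler_pM2r. by move: Msg; lra. Qed.

Lemma near_refl z : z \in s -> near z z.
Proof.
by move=> zs; rewrite /near_rel subrr cmod0 mulr_gt0 // cmod_gt0 s0.
Qed.

(** The gap improves closeness up to a factor 4 to closeness. This slack pays for the losses in
    symmetry and transitivity. *)
Lemma near_of_lt z w : z \in s -> w \in s ->
  cmod (w - z) < 4 * (sg * cmod z) -> near z w.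
Proof.
move=> zs ws h; have [//|] := sep zs ws.
have : 4 * (sg * cmod z) <= M * (sg * cmod z).
  by rewrite ler_wpM2r // mulr_ge0 ?cmod_ge0 // ltW.
by lra.
Qed.

Lemma near_cmod z w : near z w -> cmod z <= 2 * cmod w.
Proof.
rewrite /near_rel cmodB => h; have := cmod_split z w.
have : sg * cmod z <= 8^-1 * cmod z by rewrite ler_wpM2r ?cmod_ge0 // sg_small.
by have := cmod_ge0 z; lra.
Qed.

Lemma near_sym z w : z \in s -> w \in s -> near z w -> near w z.
Proof.
move=> zs ws h; apply: near_of_lt => //; have h2 := near_cmod h.
rewrite cmodB; apply: lt_le_trans h _.
have : sg * cmod z <= sg * (2 * cmod w) by rewrite ler_pM2l.
have : 0 <= sg * cmod w by rewrite mulr_ge0 ?cmod_ge0 ?ltW.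
by lra.
Qed.

Lemma near_trans z w u : z \in s -> w \in s -> u \in s ->
  near z w -> near w u -> near z u.
Proof.
move=> zs ws us h1 h2; apply: near_of_lt => //.
have h3 : sg * cmod w <= sg * (2 * cmod z).
  by rewrite ler_pM2l //; apply: near_cmod; apply: near_sym.
move: h1 h2; rewrite /near_rel => h1 h2; have := cmod_dist u w z.
have : 0 <= sg * cmod z by rewrite mulr_ge0 ?cmod_ge0 ?ltW.
by lra.
Qed.

Lemma near_rep_in z : z \in s -> rep z \in s /\ near z (rep z).
Proof.
move=> zs; have : rep z \in [seq w <- s | near z w].
  have : z \in [seq w <- s | near z w] by rewrite mem_filter near_refl.
  by rewrite /near_rep; case: [seq _ <- _ | _] => //= a l _; rewrite mem_head.
by rewrite mem_filter => /andP[].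
Qed.

Lemma near_rep_eq z w : z \in s -> w \in s -> near z w -> rep z = rep w.
Proof.
move=> zs ws h; rewrite /near_rep; congr head; apply: eq_in_filter => u us.
by apply/idP/idP => h'; [apply: near_trans h' => //; exact: near_sym
  | exact: near_trans h'].
Qed.

Lemma near_rep_sep z w : z \in s -> w \in s -> rep z != rep w ->
  M * (sg * cmod (rep z)) <= cmod (rep w - rep z).
Proof.
move=> zs ws ne; have [rz hz] := near_rep_in zs; have [rw hw] := near_rep_in ws.
have [h|//] := sep rz rw; case/eqP: ne; apply: near_rep_eq => //.
apply: near_trans (near_trans _ _ _ hz h) _ => //.
exact: near_sym.
Qed.

(** Roots in the class of [z] lie inside the annulus at half its inner radius or less, all other
    roots beyond twice its outer radius, so [t] is far from both kinds relative to their size. *)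
Lemma annulus_far z t w : z \in s -> w \in s ->
  2 * (sg * cmod z) <= cmod (t - z) <= M / 2 * (sg * cmod z) ->
  sg / 4 * cmod w <= cmod (t - w).
Proof.
move=> zs ws /andP[h1 h2].
have z0 : 0 <= sg * cmod z by rewrite mulr_ge0 ?cmod_ge0 ?ltW.
have w0 := cmod_ge0 w; have zz := cmod_ge0 z.
have hs : sg <= 8^-1 := sg_small.
have [h|h] := sep zs ws; last first.
  have hd := cmod_dist w t z; rewrite (cmodB w t) in hd.
  have h3 : cmod (w - z) <= 2 * cmod (t - w) by move: h hd h2; rewrite mulrAC; lra.
  have h4 := cmod_split w z.
  have h5 : sg * cmod w <= sg * cmod (w - z) + sg * cmod z.
    by rewrite -mulrDr ler_pM2l.
  have h6 : sg * cmod (w - z) <= 8^-1 * cmod (w - z).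
    by rewrite ler_wpM2r ?cmod_ge0.
  have h7 : 4 * (sg * cmod z) <= M * (sg * cmod z) by rewrite ler_wpM2r.
  by lra.
have h3 := near_cmod (near_sym zs ws h).
have h4 := cmod_dist t w z; move: h; rewrite /near_rel => h.
have h5 : sg * cmod w <= sg * (2 * cmod z) by rewrite ler_pM2l.
by lra.
Qed.

Lemma outside_far t w : w \in s ->
  2 * (sg * cmod (rep w)) <= cmod (t - rep w) -> sg / 4 * cmod w <= cmod (t - w).
Proof.
move=> ws h1; have [rs hr] := near_rep_in ws.
have h3 := near_cmod hr; have h' := near_sym ws rs hr.
have h4 := cmod_dist t w (rep w); move: h'; rewrite /near_rel => h'.
have h5 : sg * cmod w <= sg * (2 * cmod (rep w)) by rewrite ler_pM2l.
have : 0 <= sg * cmod w by rewrite mulr_ge0 ?cmod_ge0 ?ltW.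
by lra.
Qed.
End Separated.

(** The cells are the balls of radius [2 * (sg * cmod z)] around the representatives of the classes.
    The radius [eta] is fixed before the roots: the scale [sg] depends on them but is bounded below
    uniformly. *)
Lemma cells_exist (n L : nat) (e0 : R) : 0 < e0 <= 2^-1 ->
  exists eta : R, 0 < eta <= 2^-1 /\
  forall s s', size s = n -> size s' = n -> (forall z, z \in s -> z != 0) ->
  (forall c, c != 0 -> (count (fun z => cmod (z - c) < e0 * cmod c)%R s <= L)%N) ->
  (forall t, (forall z, z \in s -> eta * cmod z <= cmod (t - z)) ->
     2 * cmod (\prod_(z <- s) (t - z) - \prod_(z <- s') (t - z))
       <= cmod (\prod_(z <- s) (t - z))) ->
  exists N : set R[i]^o,
    [/\ forall z, z \in s -> N z,
        forall z : R[i]^o, N z ->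
          let cell := connected_component N z in
          [/\ is_open_ball cell,
              (count (fun z => `[< cell z >]) s <= L)%N &
              count (fun z => `[< cell z >]) s
                = count (fun z => `[< cell z >]) s'] &
        forall t, ~ N t -> forall z, z \in s -> eta * cmod z <= cmod (t - z)].
Proof.
(* [A] is the base of [count_roots_eq]. The factor 8 in [M] makes the outer radius
   [2 * (A ^+ 2 * rad z)] needed there half of the gap radius [M * (sg * cmod z)]. *)
move=> /andP[e00 e01]; pose A : R := 4 * 16 ^+ n; pose M : R := 8 * A ^+ 2.
have n16 : 1 <= 16 ^+ n :> R by rewrite exprn_ege1 // ler1n.
have A4 : 4 <= A by rewrite /A; lra.
have AA : A <= A ^+ 2 by rewrite expr2 ler_peMr; lra.
have M4 : 4 <= M by rewrite /M; lra.
have M1 : 1 <= M by lra.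
have M0 : 0 < M by lra.
have ME : 0 < M ^+ (n * n) by rewrite exprn_gt0.
(* The lower bound that [gap_scale] gives when started at [e0 / M] with the [n * n] relative
   distances between roots; starting there ensures [M * sg <= e0]. *)
pose smin := e0 / M / M ^+ (n * n).
have smin0 : 0 < smin by rewrite !divr_gt0.
have sminle : smin <= e0.
  rewrite /smin -mulrA; apply: ler_piMr; first exact: ltW.
  by rewrite -invfM -exprS invf_le1 ?exprn_gt0 // exprn_ege1.
exists (smin / 4); split; first by lra.
move=> s s' sn sn' s0 hc hfg.
pose xs := [seq cmod (w - z) / cmod z | z <- s, w <- s].
have [||sg [sg1 sg2 hsg]] := @gap_scale R xs M (e0 / M) (n * n) M1.
- by rewrite divr_gt0.
- by rewrite size_allpairs sn.
have sg0 : 0 < sg by apply: lt_le_trans sg1.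
have Msg0 : M * sg <= e0 by rewrite mulrC -ler_pdivlMr.
have Msg : M * sg <= 2^-1 by lra.
have sep z w : z \in s -> w \in s ->
    near_rel sg z w \/ M * (sg * cmod z) <= cmod (w - z).
  move=> zs ws; have z0 : 0 < cmod z by rewrite cmod_gt0 s0.
  have [|h|h] := hsg (cmod (w - z) / cmod z).
  - by apply/allpairsP; exists (z, w).
  - by left; rewrite /near_rel -ltr_pdivrMr.
  - by right; rewrite mulrA -ler_pdivlMr.
have etale u v : sg / 4 * cmod u <= v -> smin / 4 * cmod u <= v.
  by apply: le_trans; rewrite ler_wpM2r ?cmod_ge0 //; rewrite /smin; lra.
pose rad z := 2 * (sg * cmod z).
pose reps := [seq near_rep sg s z | z <- s].
have rin := near_rep_in s0 sg0.
have repsE z : z \in reps -> z \in s.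
  by move=> /mapP[u us ->]; case: (rin u us).
have rad0 z : z \in reps -> 0 < rad z.
  by move=> /repsE/s0 z0; rewrite /rad !mulr_gt0 // cmod_gt0.
have disj z z' : z \in reps -> z' \in reps -> z != z' ->
    rad z + rad z' <= cmod (z - z').
  move=> /mapP[u us ->] /mapP[u' us' ->] ne.
  have h1 := near_rep_sep s0 M4 sg0 Msg sep us us' ne.
  rewrite eq_sym in ne.
  have h2 := near_rep_sep s0 M4 sg0 Msg sep us' us ne.
  rewrite cmodB in h1; rewrite /rad.
  have h k : 4 * (sg * cmod k) <= M * (sg * cmod k).
    by rewrite ler_wpM2r // mulr_ge0 ?cmod_ge0 ?ltW.
  have := h (near_rep sg s u); have := h (near_rep sg s u'); lra.
pose N : set R[i]^o := fun t => exists2 z, z \in reps & cmod (z - t) < rad z.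
have comp := component_disjoint_balls rad0 disj.
exists N; split.
- move=> z zs; have [h1 h2] := rin z zs; exists (near_rep sg s z).
    by apply/mapP; exists z.
  have := near_sym M4 sg0 Msg sep zs h1 h2; rewrite /near_rel cmodB /rad.
  have : 0 <= sg * cmod (near_rep sg s z) by rewrite mulr_ge0 ?cmod_ge0 ?ltW.
  by lra.
- move=> t [z zr zt] cell; have cE : cell = ball (z : R[i]^o) (rad z)%:C.
    exact: comp zr zt.
  have zs := repsE z zr; have z0 := rad0 z zr.
  have cw w : `[< cell w >] = (cmod (w - z) < rad z).
    by rewrite cE; apply/asboolP/idP => [/in_ball|h]; [|apply/in_ball];
      rewrite cmodB.
  split; first by exists z, (rad z).
    rewrite (eq_count cw); apply: leq_trans (hc z (s0 z zs)).
    apply: sub_count => w /=; apply: (fun h a => lt_le_trans a h).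
    rewrite /rad mulrA ler_wpM2r ?cmod_ge0 //.
    by have : 4 * sg <= M * sg; [rewrite ler_pM2r|lra].
  rewrite !(eq_count cw).
  have AAz : 2 * (A ^+ 2 * rad z) = M / 2 * (sg * cmod z) by rewrite /M /rad; field.
  have off u : rad z <= cmod (u - z) <= M / 2 * (sg * cmod z) ->
      forall w, w \in s -> smin / 4 * cmod w <= cmod (u - w).
    by move=> hu w ws; apply: etale; apply: (annulus_far M4 sg0 Msg sep zs ws hu).
  apply: (@count_roots_eq R n (rad z) z s s' 1) => //.
  + by rewrite sn.
  + by rewrite sn'.
  + move=> w ws; rewrite -/A AAz; have [h|h] := sep z w zs ws; [left|right].
      apply: lt_trans h _; rewrite /rad; have := z0; rewrite /rad; lra.
    apply: le_trans h; rewrite /rad in z0.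
    by rewrite ler_wpM2r //; lra.
  + move=> w ws; rewrite -/A AAz;
    have [h|h] := ltP (cmod (w - z)) (rad z); first by left.
    have [h'|h'] := leP (M / 2 * (sg * cmod z)) (cmod (w - z)); first by right.
    (* A root [w] of [s'] in the annulus would be far from [s], so [hfg] applies at [w]; the second
       product vanishes there, and the first would be at most half of itself. *)
    have hw : forall w0, w0 \in s -> smin / 4 * cmod w0 <= cmod (w - w0).
      by apply: off; rewrite h ltW.
    have := hfg w hw; rewrite [\prod_(z <- s') _](big_rem w) //= subrr mul0r subr0.
    have : 0 < cmod (\prod_(z0 <- s) (w - z0)).
      rewrite cmod_gt0 prodf_seq_neq0; apply/allP => v vs /=.
      rewrite -cmod_gt0; apply: lt_le_trans (hw v vs).
      by rewrite !mulr_gt0 ?invr_gt0 // cmod_gt0 s0.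
    by lra.
  + move=> u hu; rewrite mul1r; apply: hfg; apply: off.
    have h1 : rad z <= A * rad z by rewrite ler_peMl //; lra.
    have h2 : A * rad z <= A ^+ 2 * rad z by rewrite ler_pM2r.
    have hx (x : R) : 0 <= x -> cmod (z + x%:C - z) = x.
      by move=> x0; rewrite addrAC subrr add0r cmod_real ger0_norm.
    by rewrite -AAz; case: hu => ->; rewrite -/A hx; lra.
- move=> t ht z zs; apply: etale; apply: (outside_far s0 M4 sg0 Msg sep zs).
  rewrite leNgt; apply/negP => h; apply: ht; exists (near_rep sg s z).
    by apply/mapP; exists z.
  by rewrite cmodB.
Qed.
End Cells.

(** * Polynomials at the scale of a tier *)

Section Tier.
Variable R : realType.
Implicit Types (s : seq R[i]) (z w t : R[i]) (G : {poly R[i]}).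

Local Notation rprod s := (\prod_(z <- s) ('X - z%:P)).

Lemma wnorm_Xsub (rho : R) z : 0 <= rho ->
  wnorm rho ('X - z%:P) <= rho + cmod z.
Proof.
move=> r0; apply: le_trans (wnormD r0 _ _) _; rewrite wnormN wnormC.
by rewrite -[X in wnorm _ X]mul1r wnormMX // -polyC1 wnormC cmod1 mul1r.
Qed.

Lemma wnorm_rprod (rho : R) s : 0 <= rho ->
  (forall z, z \in s -> cmod z <= rho) ->
  wnorm rho (rprod s) <= (2 * rho) ^+ size s.
Proof.
move=> r0 hs; have -> : (2 * rho) ^+ size s = \prod_(z <- s) (2 * rho).
  by rewrite big_const_seq count_predT iter_mulr_1.
apply: wnorm_prod => // z zs; apply: le_trans (wnorm_Xsub _ r0) _.
by have := hs z zs; lra.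
Qed.

Section Split.
Variables (s1 s2 s3 : seq R[i]) (rho d : R).
Hypothesis rho0 : 0 < rho.
Hypothesis d01 : 0 <= d <= 1.
Hypothesis h1 : forall z, z \in s1 -> rho <= d * cmod z.
Hypothesis h2 : forall z, z \in s2 -> cmod z <= rho.
Hypothesis h3 : forall z, z \in s3 -> cmod z <= d * rho.
Let N := size (s1 ++ s2 ++ s3).
Let c := \prod_(z <- s1) (- z).
Let f := rprod (s1 ++ s2 ++ s3).

(* At the scale [rho] the large roots contribute constants and the small ones
   powers of ['X]. *)
Lemma tier_approx :
  wnorm rho (f - c *: ('X^(size s3) * rprod s2))
    <= 4 ^+ N * d * (cmod c * rho ^+ (size s3 + size s2)).
Proof.
have r0 : 0 <= rho by exact: ltW.
(* The tags 0, 1, 2 mark large, tier and small roots, so that a single use of [wnorm_prod_perturb]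
   handles the three kinds of factor. *)
pose s := [seq (0%N, z) | z <- s1] ++ [seq (1%N, z) | z <- s2]
          ++ [seq (2%N, z) | z <- s3].
pose p (iz : nat * R[i]) := 'X - iz.2%:P.
pose q (iz : nat * R[i]) : {poly R[i]} :=
  match iz.1 with 0 => - iz.2%:P | 1 => 'X - iz.2%:P | _ => 'X end.
pose M (iz : nat * R[i]) : R :=
  match iz.1 with 0 => cmod iz.2 | 1 => 2 * rho | _ => rho end.
have ss : size s = N by rewrite /s /N !size_cat !size_map.
have wX : wnorm rho 'X = rho.
  by rewrite -[X in wnorm _ X]mul1r wnormMX // -polyC1 wnormC cmod1 mul1r.
have Ms : \prod_(i <- s) M i
    = cmod c * ((2 * rho) ^+ size s2 * rho ^+ size s3).
  rewrite /s !big_cat /= !big_map /M /= !big_const_seq !count_predT !iter_mulr_1.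
  by congr (_ * _); rewrite /c cmod_prod; apply: eq_bigr => z _; rewrite cmodN.
have ps : \prod_(i <- s) p i = f by rewrite /s /f !big_cat /= !big_map.
have qs : \prod_(i <- s) q i = c *: ('X^(size s3) * rprod s2).
  rewrite /s !big_cat /= !big_map /q /= big_const_seq count_predT iter_mulr_1.
  rewrite -mul_polyC /c rmorph_prod [rprod s2 * _]mulrC /=.
  by congr (_ * _); apply: eq_bigr => z _; rewrite polyCN.
have := @wnorm_prod_perturb R rho r0 _ s p q M d (andP d01).1.
rewrite ps qs ss Ms => H; apply: le_trans (H _ _) _.
- move=> i; rewrite /s !mem_cat => /orP[|/orP[]] /mapP[z zs ->]; rewrite /q /M /=.
  + by rewrite wnormN wnormC.
  + by apply: le_trans (wnorm_Xsub _ r0) _; have := h2 zs; lra.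
  + by rewrite wX.
- move=> i; rewrite /s !mem_cat => /orP[|/orP[]] /mapP[z zs ->]; rewrite /p /q /M /=.
  + by rewrite opprK subrK wX h1.
  + by rewrite subrr wnorm0 !mulr_ge0 // (andP d01).1.
  + by rewrite addrAC subrr add0r wnormN wnormC h3.
have c0 : 0 <= cmod c * (rho ^+ size s2 * rho ^+ size s3).
  by rewrite !mulr_ge0 ?exprn_ge0 ?cmod_ge0.
have -> : 4 ^+ N * d * (cmod c * rho ^+ (size s3 + size s2))
    = (2 ^+ N * d) * (2 ^+ N * (cmod c * (rho ^+ size s2 * rho ^+ size s3))).
  have -> : 4 ^+ N = 2 ^+ N * 2 ^+ N :> R.
    by rewrite -exprMn; congr (_ ^+ _); ring.
  by rewrite exprD; ring.
have -> : cmod c * ((2 * rho) ^+ size s2 * rho ^+ size s3)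
    = 2 ^+ size s2 * (cmod c * (rho ^+ size s2 * rho ^+ size s3)).
  by rewrite exprMn; ring.
apply: ler_pM.
- by rewrite subr_ge0 exprn_ege1 // lerDl (andP d01).1.
- by rewrite mulr_ge0 ?exprn_ge0.
- exact: expr1D_sub1_le.
- rewrite ler_wpM2r // ler_weXn2l ?ler1n // /N !size_cat.
  by rewrite addnCA leq_addr.
Qed.

Hypothesis Nd : 4 ^+ N * d <= 2^-1.

(** This coefficient is the top one of the approximating product, where the monic tier product
    contributes 1. *)
Lemma tier_lead_near : cmod (f`_(size s3 + size s2) - c) <= 4 ^+ N * d * cmod c.
Proof.
have r0 : 0 <= rho by exact: ltW.
have := le_trans (wnorm_coef r0 _ (size s3 + size s2)) tier_approx.
rewrite mulrA ler_pM2r ?exprn_gt0 // coefB coefZ coefXnM ltnNge leq_addr /= addKn.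
have -> : (rprod s2)`_(size s2) = 1.
  have := monicP (monic_prod_XsubC s2 xpredT id).
  by rewrite /lead_coef size_prod_XsubC.
by rewrite mulr1.
Qed.

Lemma tier_const_gt0 : 0 < cmod c.
Proof.
rewrite cmod_gt0 prodf_seq_neq0; apply/allP => z zs /=; rewrite oppr_eq0.
rewrite -cmod_gt0 lt_def cmod_ge0 andbT; apply/eqP => e.
by have := h1 zs; rewrite e mulr0 leNgt rho0.
Qed.

Lemma tier_lead_half : cmod c <= 2 * cmod f`_(size s3 + size s2).
Proof.
have := tier_lead_near; have := cmod_split c f`_(size s3 + size s2).
rewrite cmodB.
have : 4 ^+ N * d * cmod c <= 2^-1 * cmod c by rewrite ler_wpM2r ?cmod_ge0.
by lra.
Qed.

Lemma tier_lead_neq0 : f`_(size s3 + size s2) != 0.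
Proof. by rewrite -cmod_gt0; have := tier_lead_half; have := tier_const_gt0; lra. Qed.

(** [G] is given with the division cleared. Its numerator and denominator are [c] times coefficients
    of the tier product up to a relative error of order [d], and [tier_lead_half] keeps the
    denominator away from 0. *)
Lemma tier_slice G :
  (forall e, (e <= size s2)%N ->
     f`_(size s3 + size s2) * G`_e = f`_(size s3 + e)) ->
  forall e, (e <= size s2)%N ->
    cmod (G - rprod s2)`_e <= 4 * 8 ^+ N * d * rho ^+ (size s2 - e).
Proof.
move=> hG e he; have r0 : 0 <= rho by exact: ltW.
set b := size s3 in hG *; set D := size s2 in hG he *.
have E1 := le_trans (wnorm_coef r0 _ (b + e)) tier_approx.
have {}E1 : cmod (f`_(b + e) - c * (rprod s2)`_e)
    <= 4 ^+ N * d * (cmod c * rho ^+ (D - e)).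
  move: E1; rewrite coefB coefZ coefXnM ltnNge leq_addr /= addKn.
  have -> : rho ^+ (size s3 + size s2) = rho ^+ (D - e) * rho ^+ (b + e).
    by rewrite -exprD; congr (_ ^+ _); move: he; rewrite -/b -/D; lia.
  by rewrite !mulrA ler_pM2r ?exprn_gt0 // -!mulrA.
have E2 := tier_lead_near; have E3 := tier_lead_half; have c0 := tier_const_gt0.
rewrite -/b -/D in E2 E3.
have E4 : cmod (rprod s2)`_e <= 2 ^+ N * rho ^+ (D - e).
  have := le_trans (wnorm_coef r0 _ e) (wnorm_rprod r0 h2).
  have -> : (2 * rho) ^+ size s2 = 2 ^+ D * rho ^+ (D - e) * rho ^+ e.
    by rewrite exprMn -mulrA -exprD subnK.
  rewrite ler_pM2r ?exprn_gt0 // => H; apply: le_trans H _.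
  rewrite ler_wpM2r ?exprn_ge0 // ler_weXn2l ?ler1n // /N !size_cat.
  by rewrite -/D addnCA leq_addr.
rewrite coefB; set g := _ - _.
have E5 : cmod f`_(b + D) * cmod g <= 4 ^+ N * d * (cmod c * rho ^+ (D - e))
    + 4 ^+ N * d * cmod c * (2 ^+ N * rho ^+ (D - e)).
  rewrite -cmodM /g mulrBr hG //.
  have -> : f`_(b + e) - f`_(b + D) * (rprod s2)`_e
    = (f`_(b + e) - c * (rprod s2)`_e) + - ((f`_(b + D) - c) * (rprod s2)`_e) by ring.
  apply: le_trans (cmodD _ _) _; rewrite cmodN cmodM; apply: lerD => //.
  by apply: ler_pM; rewrite ?cmod_ge0.
have E6 : cmod c * cmod g <= 2 * (cmod f`_(b + D) * cmod g).
  by rewrite mulrA ler_wpM2r ?cmod_ge0.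
have [d0 _] := andP d01.
have X0 : 0 <= d * rho ^+ (D - e) by rewrite mulr_ge0 ?exprn_ge0.
have h21 : 1 <= 2 ^+ N :> R by rewrite exprn_ege1 // ler1n.
rewrite -(ler_pM2l c0); apply: le_trans E6 _.
apply: le_trans (ler_wpM2l _ E5) _ => //.
have -> : 8 ^+ N = 4 ^+ N * 2 ^+ N :> R.
  by rewrite -exprMn; congr (_ ^+ _); ring.
have Y0 : 0 <= cmod c * (4 ^+ N * (d * rho ^+ (D - e))).
  by rewrite !mulr_ge0 ?cmod_ge0 ?exprn_ge0.
have := ler_wpM2l Y0 h21; set x := 4 ^+ N; set y := 2 ^+ N.
set u := rho ^+ _; lra.
Qed.

(** Put [tau = max rho |t|]. Away from the tier roots each [cmod (t - z)] is at least [tau] divided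
    by [2 * C1 / eta], so the product dominates [tau ^+ size s2], which is the size of the error
    given by [tier_slice] and [cmod_horner_le]. *)
Lemma tier_close G (C1 eta : R) t : 1 <= C1 -> 0 < eta <= 2^-1 ->
  (forall z, z \in s2 -> rho <= C1 * cmod z) ->
  (forall z, z \in s2 -> eta * cmod z <= cmod (t - z)) ->
  (size G <= (size s2).+1)%N ->
  (forall e, (e <= size s2)%N ->
     f`_(size s3 + size s2) * G`_e = f`_(size s3 + e)) ->
  cmod (G.[t] - \prod_(z <- s2) (t - z))
    <= N.+1%:R * (4 * 8 ^+ N * d) * (2 * C1 / eta) ^+ N
       * cmod (\prod_(z <- s2) (t - z)).
Proof.
move=> C11 /andP[eta0 eta1] hC ht sG hG.
have [d0 _] := andP d01; have r0 : 0 <= rho by exact: ltW.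
pose tau := Num.max rho (cmod t); pose k := 2 * C1 / eta.
have k0 : 0 < k by rewrite divr_gt0 //; lra.
have k1 : 1 <= k by rewrite ler_pdivlMr // mul1r; lra.
have hz z : z \in s2 -> tau <= k * cmod (t - z).
  move=> zs; have a := ht z zs; have b := hC z zs; have c' := cmod_split t z.
  rewrite /tau ge_max /k mulrAC !ler_pdivlMr //; have z0 := cmod_ge0 z.
  have w0 := cmod_ge0 (t - z).
  have x1 : C1 * (eta * cmod z) <= C1 * cmod (t - z) by rewrite ler_wpM2l //; lra.
  have x2 : eta * rho <= eta * (C1 * cmod z) by rewrite ler_pM2l.
  have x3 : eta * cmod t <= eta * (cmod (t - z) + cmod z) by rewrite ler_pM2l.
  have x4 : 1 * cmod (t - z) <= C1 * cmod (t - z) by rewrite ler_wpM2r.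
  have x5 : eta * cmod (t - z) <= 2^-1 * cmod (t - z) by rewrite ler_wpM2r.
  by apply/andP; split; lra.
have tau0 : 0 < tau by rewrite lt_max rho0.
have P1 : tau ^+ size s2 <= k ^+ size s2 * cmod (\prod_(z <- s2) (t - z)).
  rewrite cmod_prod; elim: (s2) hz => [|z s IH] hz.
    by rewrite big_nil !expr0 mulr1.
  rewrite big_cons /= !exprS mulrACA; apply: ler_pM; rewrite ?exprn_ge0 ?(ltW tau0) //.
    by apply: hz; rewrite mem_head.
  by apply: IH => w hw; apply: hz; rewrite inE hw orbT.
have E : cmod (G - rprod s2).[t]
    <= (size s2).+1%:R * (4 * 8 ^+ N * d) * tau ^+ size s2.
  apply: (@cmod_horner_le _ _ _ _ rho).
  - apply: leq_trans (size_polyD _ _) _; rewrite geq_max sG size_polyN.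
    by rewrite size_prod_XsubC leqnn.
  - by rewrite !mulr_ge0 ?exprn_ge0.
  - by rewrite r0 le_max lexx.
  - by rewrite le_max lexx orbT.
  - exact: tier_slice.
move: E; rewrite hornerD hornerN horner_prod.
under eq_bigr do rewrite hornerXsubC.
move=> E; apply: le_trans E _.
have sN : (size s2 <= N)%N by rewrite /N !size_cat addnCA leq_addr.
rewrite -/k -[X in _ <= X]mulrA; set B := 4 * 8 ^+ N * d.
have B0 : 0 <= B by rewrite !mulr_ge0 ?exprn_ge0.
apply: ler_pM; rewrite ?mulr_ge0 ?exprn_ge0 ?(ltW tau0) //.
  by rewrite ler_wpM2r // ler_nat.
apply: le_trans P1 _; rewrite ler_wpM2r ?cmod_ge0 //.
by rewrite ler_weXn2l.
Qed.
End Split.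

End Tier.

(** * Gaps and coefficients *)

Section Gap.
Variable R : realType.
Variable s : seq R[i].
Local Notation n := (size s).
Local Notation a i := (cmod (s`_i)).
Local Notation f := (\prod_(z <- s) ('X - z%:P)).
Hypothesis s_neq0 : forall z, z \in s -> z != 0.
Hypothesis s_sorted : forall i j, (i <= j < n)%N -> a j <= a i.

Lemma nth_cmod_gt0 i : (i < n)%N -> 0 < a i.
Proof. by move=> hi; rewrite cmod_gt0 s_neq0 // mem_nth. Qed.

Lemma mem_drop_cmod i z : z \in drop i s -> cmod z <= a i.
Proof.
move=> /(nthP 0)[j]; rewrite size_drop nth_drop => hj <-.
by apply: s_sorted; rewrite leq_addr -ltn_subRL.
Qed.

Lemma mem_take_cmod i z : (i <= n)%N -> z \in take i s -> a i.-1 <= cmod z.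
Proof.
move=> hi /(nthP 0)[j]; rewrite size_takel // => hj <-.
by rewrite nth_take //; apply: s_sorted; lia.
Qed.

(* A quotient [gap_const n] between consecutive moduli forces a nonzero
   coefficient, by [tier_lead_neq0] at their geometric mean with an empty tier. *)
Definition gap_const (m : nat) : R := (2 * 4 ^+ m) ^+ 2.

Lemma gap_const_ge1 m : 1 <= gap_const m.
Proof.
have : 1 <= 4 ^+ m :> R by rewrite exprn_ege1 // ler1n.
by move=> h; rewrite /gap_const exprn_ege1 //; lra.
Qed.

Lemma coef_gap_neq0 i : (0 < i < n)%N ->
  gap_const n * a i <= a i.-1 -> f`_(n - i) != 0.
Proof.
move=> /andP[i0 hi] hgap; pose q : R := 2 * 4 ^+ n.
have h4 : 1 <= 4 ^+ n :> R by rewrite exprn_ege1 // ler1n.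
have q0 : 0 < q by rewrite /q; lra.
have ai := nth_cmod_gt0 hi.
have E : s = take i s ++ [::] ++ drop i s by rewrite /= cat_take_drop.
have := @tier_lead_neq0 R (take i s) [::] (drop i s) (q * a i) q^-1.
rewrite /= cat_take_drop addn0 size_drop; apply.
- by rewrite mulr_gt0.
- by rewrite invr_ge0 ltW //= invf_le1 // /q; lra.
- move=> z /(mem_take_cmod (ltnW hi)) hz; rewrite ler_pdivlMl //.
  by apply: le_trans hz; apply: le_trans hgap; rewrite mulrA -expr2.
- by [].
- by move=> z /mem_drop_cmod hz; rewrite mulKf // gt_eqF.
- by rewrite /q invfM mulrCA divff ?mulr1 // gt_eqF //; lra.
Qed.

(** By [coef_gap_neq0], a vanishing coefficient excludes a large quotient at its position; the
    bounds for the [j - i] consecutive quotients multiply. *)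
Lemma gapless_cmod i j : (i <= j < n)%N ->
  (forall m, (i < m <= j)%N -> f`_(n - m) = 0) ->
  a i <= gap_const n ^+ (j - i) * a j.
Proof.
move=> /andP[ij jn] h; have K1 := gap_const_ge1 n.
have K0 : 0 <= gap_const n by apply: le_trans K1.
elim: j ij jn h => [|j IH] ij jn h.
  by move: ij; rewrite leqn0 => /eqP ->; rewrite expr0 mul1r.
have [<-|ne] := eqVneq i j.+1; first by rewrite subnn expr0 mul1r.
have ij' : (i <= j)%N by rewrite -ltnS ltn_neqAle ne ij.
have {}IH : a i <= gap_const n ^+ (j - i) * a j.
  by apply: IH => // [|m hm]; [exact: ltnW|apply: h; lia].
apply: le_trans IH _; rewrite subSn // exprSr -mulrA.
rewrite ler_wpM2l ?exprn_ge0 // leNgt; apply/negP => /ltW hlt.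
have := @coef_gap_neq0 j.+1 jn hlt; rewrite h ?eqxx //.
by rewrite ltnS ij' leqnn.
Qed.
End Gap.

(** * Complex roots of monic real polynomials *)

Section Roots.
Variable R : realType.
Implicit Types p : {poly R}.

Lemma cpoly_monic p : p \is monic ->
  cpoly p = \prod_(z <- croots p) ('X - z%:P).
Proof.
move=> mp; rewrite /croots (perm_big _ (permEl (perm_sort _ _))) /=.
case: closed_field_poly_normal => rs /= ->.
by rewrite (monicP _) ?map_monic // scale1r.
Qed.

Lemma size_croots p : p \is monic -> size (croots p) = (size p).-1.
Proof.
move=> mp; have := congr1 (fun q : {poly R[i]} => size q) (cpoly_monic mp).
by rewrite /= size_prod_XsubC /cpoly size_map_poly => ->.
Qed.

Lemma root_cpoly p z : p \is monic -> root (cpoly p) z = (z \in croots p).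
Proof. by move=> mp; rewrite cpoly_monic // root_prod_XsubC. Qed.

Lemma croots_sorted p i j : (i <= j < size (croots p))%N ->
  cmod (croots p)`_j <= cmod (croots p)`_i.
Proof.
move=> /andP[ij js].
have tot : total (fun z w : R[i] => `|w| <= `|z|).
  by move=> z w; rewrite !cmodE !lecR; exact: le_total.
have tr : transitive (fun z w : R[i] => `|w| <= `|z|).
  by move=> y x z h1 h2; exact: le_trans h2 h1.
have := sorted_leq_nth tr (fun z => lexx `|z|) 0 (sort_sorted tot _).
move=> /(_ _ i j) H; rewrite -lecR -!cmodE; apply: H => //.
by rewrite inE (leq_ltn_trans ij).
Qed.

Lemma horner_cpoly p t : p \is monic ->
  (cpoly p).[t] = \prod_(z <- croots p) (t - z).
Proof.
move=> mp; rewrite cpoly_monic // horner_prod.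
by apply: eq_bigr => z _; rewrite hornerXsubC.
Qed.

End Roots.

(** * Exponents, partial sums of the composition, and coefficients of the factors *)

Section Exponents.
Variables (R : realType) (L : nat) (k : nat -> nat).
Hypothesis kS : forall i j : nat, (i < j <= L)%N -> (k i < k j)%N.
Variable y : nat -> R.

Lemma k_mono i j : (i <= j <= L)%N -> (k i <= k j)%N.
Proof.
move=> /andP[ij jL]; have [->//|ne] := eqVneq i j.
by apply: ltnW; apply: kS; rewrite ltn_neqAle ne ij.
Qed.

Lemma leq_k i : (i <= L)%N -> (i <= k i)%N.
Proof.
elim: i => // i IH hi; apply: leq_ltn_trans (IH (ltnW hi)) _.
by apply: kS; rewrite ltnSn.
Qed.

Lemma k_inj i j : (i <= L)%N -> (j <= L)%N -> k i = k j -> i = j.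
Proof.
move=> iL jL e; have [lt|gt|//] := ltngtP i j.
  by have := kS (i := i) (j := j); rewrite lt jL e ltnn => /(_ isT).
by have := kS (i := j) (j := i); rewrite gt iL e ltnn => /(_ isT).
Qed.

Lemma coef_Psi m :
  (Psi L k y)`_m = \sum_(0 <= j < L.+1) (if k j == m then y j else 0).
Proof.
rewrite /Psi coef_sum; apply: eq_bigr => j _.
by rewrite coefZ coefXn eq_sym; case: eqP; rewrite ?mulr1 ?mulr0.
Qed.

Lemma coef_Psi_k j : (j <= L)%N -> (Psi L k y)`_(k j) = y j.
Proof.
move=> jL; rewrite coef_Psi big_mkord (bigD1 (Ordinal (jL : (j < L.+1)%N))) //=.
rewrite eqxx big1 ?addr0 // => i ne; case: eqP => // e.
case/eqP: ne; apply: val_inj => /=; apply: k_inj => //.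
by rewrite -ltnS.
Qed.

Lemma coef_Psi_gap m : (forall j, (j <= L)%N -> k j != m) -> (Psi L k y)`_m = 0.
Proof.
move=> h; rewrite coef_Psi big_mkord big1 // => j _.
by rewrite (negPf (h j _)) // -ltnS.
Qed.

Lemma size_Psi_le : (size (Psi L k y) <= (k L).+1)%N.
Proof.
apply/leq_sizeP => m hm; apply: coef_Psi_gap => j jL.
have := @k_mono j L; rewrite jL leqnn => /(_ isT); lia.
Qed.

Hypothesis yL : y L = 1.

Lemma size_Psi : size (Psi L k y) = (k L).+1.
Proof.
apply/eqP; rewrite eqn_leq size_Psi_le ltnNge; apply/negP => h.
have := coef_Psi_k (leqnn L); rewrite yL nth_default // => /eqP.
by rewrite eq_sym oner_eq0.
Qed.

Lemma Psi_monic : Psi L k y \is monic.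
Proof. by rewrite monicE /lead_coef size_Psi /= coef_Psi_k ?leqnn // yL. Qed.

Lemma cpoly_Psi :
  cpoly (Psi L k y) = \sum_(j < L.+1) (y j)%:C *: 'X^(k j).
Proof.
rewrite /cpoly /Psi raddf_sum big_mkord; apply: eq_bigr => j _ /=.
by rewrite map_polyZ map_polyXn.
Qed.

Variable l : seq nat.
Hypothesis compl : composition L l.

Lemma LsumS r : (r < size l)%N -> Lsum l r.+1 = (Lsum l r + nth 0%N l r)%N.
Proof. by move=> h; rewrite /Lsum (take_nth 0%N h) sumn_rcons. Qed.

Lemma LsumS_lt r : (r < size l)%N -> (Lsum l r < Lsum l r.+1)%N.
Proof.
move=> h; rewrite LsumS // -[X in (X < _)%N]addn0 ltn_add2l.
by case: compl => /allP H _; apply: H; rewrite mem_nth.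
Qed.

Lemma Lsum_mono r r' : (r <= r' <= size l)%N -> (Lsum l r <= Lsum l r')%N.
Proof.
move=> /andP[]; elim: r' => [|r' IH]; first by rewrite leqn0 => /eqP ->.
rewrite leq_eqVlt => /orP[/eqP ->//|h] hs.
by apply: leq_trans (IH h (ltnW hs)) (ltnW (LsumS_lt hs)).
Qed.

Lemma Lsum_size : Lsum l (size l) = L.
Proof. by rewrite /Lsum take_size; case: compl. Qed.

Lemma Lsum_le r : (r <= size l)%N -> (Lsum l r <= L)%N.
Proof. by move=> h; rewrite -[X in (_ <= X)%N]Lsum_size Lsum_mono // h leqnn. Qed.

Lemma size_comp_le : (size l <= L)%N.
Proof.
have H r : (r <= size l)%N -> (r <= Lsum l r)%N.
  by elim: r => // r IH h; apply: leq_ltn_trans (IH (ltnW h)) (LsumS_lt h).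
by rewrite -Lsum_size; apply: H.
Qed.

Local Notation e r := (k (L - Lsum l r)%N).

(** The factor is the slice of [Psi] between the exponents [e r] and [e r.-1], shifted to degree 0.
    Strict monotonicity of [k] keeps terms outside the slice from contributing. *)
Lemma coef_tPsi_fac r i : (0 < r <= size l)%N -> (e r + i <= e r.-1)%N ->
  (tPsi_fac L k y l r)`_i = (y (L - Lsum l r.-1)%N)^-1 * (Psi L k y)`_(e r + i).
Proof.
case: r => // r hr hi; rewrite /= in hr hi *.
rewrite /tPsi_fac coefZ coef_sum; congr (_ * _).
have h1 := LsumS hr; have h2 := Lsum_le hr.
rewrite coef_Psi.
set b := (L - Lsum l r.+1)%N in hi *; set m := nth _ _ _ in h1 *.
have E : (L - Lsum l r)%N = (b + m)%N by rewrite /b; lia.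
have bmL : (b + m <= L)%N by lia.
rewrite E in hi.
have bL : (b <= L.+1)%N by lia.
have bm : (b <= (b + m).+1)%N by lia.
have bmS : ((b + m).+1 <= L.+1)%N by lia.
rewrite (big_cat_nat (leq0n b) bL) /=.
rewrite [X in X + _]big1_seq ?add0r; last first.
  move=> j /andP[_]; rewrite mem_index_iota => hj; case: eqP => // ej.
  by have := kS (i := j) (j := b); lia.
rewrite (big_cat_nat bm bmS) /=.
rewrite [X in _ + X]big1_seq ?addr0; last first.
  move=> j /andP[_]; rewrite mem_index_iota => hj; case: eqP => // ej.
  by have := kS (i := (b + m)%N) (j := j); lia.
rewrite -[X in \sum_(X <= _ < (b + m).+1) _]add0n big_addn subSn ?leq_addr // addKn.
rewrite !big_mkord; apply: eq_bigr => j _; rewrite coefZ coefXn.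
have := @k_mono b (j + b); have := ltn_ord j; rewrite [(b + j)%N]addnC => h3 h4.
have <- : (i == (k (j + b) - k b))%N = (k (j + b) == k b + i)%N.
  by apply/eqP/eqP; lia.
by case: eqP; rewrite ?mulr1 ?mulr0.
Qed.

Lemma size_tPsi_fac_le r : (0 < r <= size l)%N ->
  (size (tPsi_fac L k y l r) <= (e r.-1 - e r).+1)%N.
Proof.
case: r => // r hr; rewrite /= in hr *.
have h1 := LsumS hr; have h2 := Lsum_le hr.
apply: leq_trans (size_scale_leq _ _) _.
apply: leq_trans (size_sum _ _ _) _; apply/bigmax_leqP_seq => j.
rewrite mem_index_iota /= => hj _; apply: leq_trans (size_scale_leq _ _) _.
rewrite size_polyXn ltnS leq_sub2r //; apply: k_mono; lia.
Qed.

Lemma e_mono r : (0 < r <= size l)%N -> (e r < e r.-1)%N.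
Proof.
case: r => // r hr; rewrite /= in hr *; apply: kS.
by have := LsumS_lt hr; have := Lsum_le hr; lia.
Qed.

Lemma tPsi_fac_monic r : (0 < r <= size l)%N -> y (L - Lsum l r.-1)%N != 0 ->
  tPsi_fac L k y l r \is monic /\
  size (tPsi_fac L k y l r) = (e r.-1 - e r).+1.
Proof.
move=> hr y0; have he := ltnW (e_mono hr).
have c1 : (tPsi_fac L k y l r)`_(e r.-1 - e r) = 1.
  by rewrite coef_tPsi_fac ?subnKC // coef_Psi_k ?leq_subr // mulVf.
have sz : size (tPsi_fac L k y l r) = (e r.-1 - e r).+1.
  apply/eqP; rewrite eqn_leq size_tPsi_fac_le // ltnNge; apply/negP => h.
  by move/eqP: c1; rewrite nth_default // eq_sym oner_eq0.
by rewrite monicE /lead_coef sz c1.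
Qed.
End Exponents.

(** * The tier regime *)

Section Regime.
Variables (R : realType) (L : nat) (k : nat -> nat).
Hypothesis kS : forall i j : nat, (i < j <= L)%N -> (k i < k j)%N.
Variables (C K : R) (l : seq nat) (y : nat -> R).
Hypothesis compl : composition L l.

Local Notation n := (k L).
Local Notation zs := (croots (Psi L k y)).
Local Notation a i := (cmod zs`_i).
Local Notation D := (Ddeg L k).
Local Notation e r := (k (L - Lsum l r)%N).
Local Notation f := (\prod_(z <- zs) ('X - z%:P)).

(** The number of roots in the first [r] tiers, hence the position, counted from 0, of the first
    root of tier [r.+1]. *)
Definition tier_start r := D (Lsum l r).
Definition tier_roots r : seq R[i] :=
  drop (tier_start r.-1) (take (tier_start r) zs).
(** [C] compares the reference heights within a tier; the power of [gap_const] compares a root with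
    the reference height of its own block. *)
Definition comp_const (m : nat) : R := C * gap_const R m ^+ m.

Lemma tier_startE r : (r <= size l)%N -> (tier_start r + e r)%N = n.
Proof.
move=> hr; rewrite /tier_start /Ddeg subnK //; apply: (k_mono kS).
by rewrite leq_subr leqnn.
Qed.

Lemma tier_start0 : tier_start 0 = 0%N.
Proof. by rewrite /tier_start /Ddeg /Lsum take0 subn0 subnn. Qed.

Lemma tier_start_lt r : (0 < r <= size l)%N -> (tier_start r.-1 < tier_start r)%N.
Proof.
move=> hr; have h1 := e_mono kS compl hr.
have h2 : (r <= size l)%N by case/andP: hr.
have h3 := tier_startE h2; have h4 := tier_startE (leq_trans (leq_pred r) h2).
by lia.
Qed.

Lemma tier_start_le r : (r <= size l)%N -> (tier_start r <= n)%N.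
Proof. by move=> h; rewrite -(tier_startE h) leq_addr. Qed.

Lemma D_mono i j : (i <= j)%N -> (D i <= D j)%N.
Proof. by move=> ij; rewrite /Ddeg leq_sub2l //; apply: (k_mono kS); lia. Qed.

Lemma zs_tier r : (0 < r <= size l)%N ->
  zs = take (tier_start r.-1) zs ++ tier_roots r ++ drop (tier_start r) zs.
Proof.
move=> hr; rewrite catA /tier_roots.
have -> : take (tier_start r.-1) zs = take (tier_start r.-1) (take (tier_start r) zs).
  by rewrite take_takel // ltnW // tier_start_lt.
by rewrite !cat_take_drop.
Qed.

Lemma prod_tier_roots (F : R[i] -> R[i]) m : (m <= size l)%N ->
  \prod_(1 <= r < m.+1) \prod_(z <- tier_roots r) F z
    = \prod_(z <- take (tier_start m) zs) F z.
Proof.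
elim: m => [|m IH] hm; first by rewrite big_geq // tier_start0 take0 big_nil.
rewrite big_nat_recr //= IH ?(ltnW hm) // -big_cat /tier_roots /=.
have -> : take (tier_start m) zs = take (tier_start m) (take (tier_start m.+1) zs).
  by rewrite take_takel // ltnW // (@tier_start_lt m.+1).
by rewrite cat_take_drop.
Qed.

Lemma zs_sorted i j : (i <= j < size zs)%N -> a j <= a i.
Proof. exact: croots_sorted. Qed.

Hypothesis k0 : k 0 = 0%N.

Lemma tier_start_size : tier_start (size l) = n.
Proof.
by have := tier_startE (leqnn _); rewrite (Lsum_size compl) subnn k0 addn0.
Qed.

Lemma find_block i : (i < n)%N -> exists2 j, (j < L)%N & (D j <= i < D j.+1)%N.
Proof.
move=> hi; have H j : (j <= L)%N -> (i < D j)%N ->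
    exists2 j, (j < L)%N & (D j <= i < D j.+1)%N.
  elim: j => [|j IH] jL; first by rewrite /Ddeg subn0 subnn.
  move=> h; have [h'|h'] := ltnP i (D j); first exact: IH (ltnW jL) h'.
  by exists j => //; rewrite h'.
by apply: (H L (leqnn L)); rewrite /Ddeg subnn k0 subn0.
Qed.

Hypothesis yL : y L = 1.

Lemma size_zs : size zs = n.
Proof. by rewrite size_croots ?Psi_monic // size_Psi. Qed.

Lemma coef_f m : f`_m = ((Psi L k y)`_m)%:C.
Proof. by rewrite -cpoly_monic ?Psi_monic // /cpoly coef_map. Qed.

Lemma tier_rootsP r z : (0 < r <= size l)%N -> z \in tier_roots r ->
  exists2 i, (tier_start r.-1 <= i < tier_start r)%N & z = zs`_i.
Proof.
move=> /andP[_ hr] /(nthP 0)[j];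
rewrite size_drop size_takel ?size_zs ?tier_start_le // => hj.
rewrite nth_drop nth_take; last by lia.
by move=> <-; exists (tier_start r.-1 + j)%N; first by lia.
Qed.

Hypothesis reg : tier_regime L k l C K (Psi L k y).

(** The regime separates from the last reference height of tier [r]; since the roots are sorted, the
    first modulus of the tier is at least as large. *)
Lemma tier_sep r : (0 < r < size l)%N ->
  K * a (tier_start r) <= a (tier_start r.-1).
Proof.
move=> hr; have [_ ts] := reg; have := ts r hr.
rewrite /height !cmodE -rmorphM lecR /= => h; apply: le_trans h _.
have hr' : (0 < r <= size l)%N by lia.
have := tier_start_le (r := r); have h3 := tier_start_lt hr'.
have : (Lsum l r.-1 < Lsum l r)%N.
  by case: r hr {ts h3} hr' => // r hr _; apply: (LsumS_lt compl); lia.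
move=> h1 h2; apply: zs_sorted; rewrite size_zs.
have h4 : (D (Lsum l r.-1) <= D (Lsum l r).-1)%N by apply: D_mono; lia.
rewrite /tier_start h4 /=.
have h5 := Lsum_le compl (r := r).
have h6 : (L - Lsum l r < L - (Lsum l r).-1)%N by have := h5 _; lia.
have := kS (i := 0) (j := L - (Lsum l r).-1); have := kS (i := 0) (j := L).
by rewrite /Ddeg; lia.
Qed.

Hypothesis y0 : y 0 != 0.

Lemma zs_neq0 z : z \in zs -> z != 0.
Proof.
rewrite -root_cpoly ?Psi_monic // => hz; apply/eqP => e0; move: hz.
rewrite e0 /root horner_coef0 /cpoly coef_map /=.
have := coef_Psi_k kS y (leq0n L); rewrite k0 => ->.
by rewrite (inj_eq (@complexI R) _ 0) (negPf y0).
Qed.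

(** For [m] with [D j < m <= i], the degree [n - m] lies strictly between the consecutive exponents
    [k (L - j.+1)] and [k (L - j)], so its coefficient vanishes and [gapless_cmod] applies. *)
Lemma block_cmod j i : (j < L)%N -> (D j <= i < D j.+1)%N ->
  a (D j) <= gap_const R n ^+ n * a i.
Proof.
move=> jL /andP[h1 h2].
have DL : (D j.+1 <= n)%N by rewrite /Ddeg leq_subr.
have := @gapless_cmod R zs zs_neq0 zs_sorted (D j) i; rewrite size_zs.
move=> H; apply: le_trans (H _ _) _.
- by lia.
- move=> m hm; rewrite coef_f coef_Psi_gap ?rmorph0 // => i' hi'; apply/eqP => em.
  have k1 := @k_mono L k kS i' (L - j.+1); have k2 := @k_mono L k kS (L - j) i'.
  have k3 := @k_mono L k kS (L - j) L; have k4 := @k_mono L k kS (L - j.+1) L.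
  have [h|h] := leqP i' (L - j.+1).
    by move: k1 hm h1 h2; rewrite /Ddeg; lia.
  by move: k2 hm h1 h2; rewrite /Ddeg; lia.
- rewrite ler_wpM2r ?cmod_ge0 // ler_weXn2l ?gap_const_ge1 //; lia.
Qed.

Lemma tier_start_cmod_gt0 r : (0 < r <= size l)%N -> 0 < a (tier_start r.-1).
Proof.
move=> hr; apply: (nth_cmod_gt0 zs_neq0); rewrite size_zs.
by have := tier_start_lt hr; have := @tier_start_le r; lia.
Qed.

Hypothesis C1 : 1 <= C.

Lemma comp_const_ge1 m : 1 <= comp_const m.
Proof.
by rewrite -[1]mulr1 ler_pM // exprn_ege1 // gap_const_ge1.
Qed.

Lemma tier_lower r i : (0 < r <= size l)%N ->
  (tier_start r.-1 <= i < tier_start r)%N ->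
  a (tier_start r.-1) <= comp_const n * a i.
Proof.
move=> hr /andP[h1 h2]; have hrl : (r <= size l)%N by case/andP: hr.
have i_n : (i < n)%N by apply: leq_trans h2 (tier_start_le hrl).
have [j jL hj] := find_block i_n; have Hj := block_cmod jL hj.
have /andP[j1 j2] := hj.
have l1 : (Lsum l r.-1 <= j)%N.
  by rewrite -ltnS ltnNge; apply/negP => /D_mono; rewrite -/(tier_start _); lia.
have l2 : (j < Lsum l r)%N.
  by rewrite ltnNge; apply/negP => /D_mono; rewrite -/(tier_start _); lia.
have [tc _] := reg.
have l3 : (Lsum l r.-1 < Lsum l r)%N by apply: leq_ltn_trans l2.
(* Heights are numbered from 1: height [j.+1] reads position [D j]. *)
have := tc r (Lsum l r.-1).+1 j.+1 hr.
rewrite !ltnS !leqnn l1 l2 l3 => /(_ isT isT).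
rewrite /height !cmodE -rmorphM lecR /= => tc'.
apply: le_trans tc' _; rewrite /comp_const -mulrA ler_wpM2l //.
by apply: le_trans C1.
Qed.

Lemma tier_roots_cmod r z : (0 < r <= size l)%N -> z \in tier_roots r ->
  cmod z <= a (tier_start r.-1) <= comp_const n * cmod z.
Proof.
move=> hr /(tier_rootsP hr)[i hi ->]; rewrite (tier_lower hr hi) andbT.
apply: zs_sorted; rewrite size_zs.
by have := @tier_start_le r; lia.
Qed.

Variable d : R.
Hypothesis d01 : 0 < d <= 1.
Hypothesis nd : 4 ^+ n * d <= 2^-1.
Hypothesis dK : comp_const n = d * K.

Let c1 : 1 <= comp_const n := comp_const_ge1 n.

Lemma K_gt0 : 0 < K.
Proof.
have [d0 _] := andP d01; rewrite -(pmulr_rgt0 _ d0) -dK.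
exact: lt_le_trans ltr01 c1.
Qed.

(** Separation bounds the first modulus of the previous tier below by [K] times the present one;
    passing to the last root of that tier loses [comp_const n]. The relation [dK] makes the net
    quotient exactly [d]. *)
Lemma large_roots r z : (0 < r <= size l)%N ->
  z \in take (tier_start r.-1) zs -> a (tier_start r.-1) <= d * cmod z.
Proof.
case: r => // -[|r] hr; first by rewrite tier_start0 take0.
have hr1 : (0 < r.+1 <= size l)%N by lia.
have h0 : (tier_start r.+1 <= size zs)%N by rewrite size_zs tier_start_le; lia.
move=> /(mem_take_cmod zs_sorted h0) /= hz.
have hr2 : (0 < r.+1 < size l)%N by lia.
have h1 := tier_sep hr2; have h3 := tier_start_lt hr1.
have := @tier_lower r.+1 (tier_start r.+1).-1 hr1; rewrite /= in h1 h3 *.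
move=> /(_ _) h2; have {}h2 : a (tier_start r) <= comp_const n * a (tier_start r.+1).-1.
  by apply: h2; lia.
rewrite -(ler_pM2l K_gt0); apply: le_trans h1 _; apply: le_trans h2 _.
rewrite mulrA [K * d]mulrC -dK ler_wpM2l //; exact: le_trans c1.
Qed.

Lemma small_roots r z : (0 < r <= size l)%N ->
  z \in drop (tier_start r) zs -> cmod z <= d * a (tier_start r.-1).
Proof.
move=> hr; have [e1|ne] := eqVneq r (size l).
  by rewrite {1}e1 tier_start_size -size_zs drop_size.
move=> /(mem_drop_cmod zs_sorted) hz.
have hr2 : (0 < r < size l)%N by move: hr ne; lia.
have h1 := tier_sep hr2; apply: le_trans hz _.
rewrite -(ler_pM2l K_gt0); apply: le_trans h1 _.
rewrite mulrA [K * d]mulrC -dK ler_peMl //; exact: cmod_ge0.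
Qed.

Lemma size_tier_roots r : (0 < r <= size l)%N ->
  (size (drop (tier_start r) zs) = e r) *
  (size (tier_roots r) = e r.-1 - e r)%N *
  (e r + (e r.-1 - e r) = e r.-1)%N.
Proof.
move=> hr; have hrl : (r <= size l)%N by case/andP: hr.
have h1 := tier_startE hrl; have h2 := @tier_startE r.-1.
have h3 := tier_start_lt hr; have h4 := e_mono kS compl hr.
rewrite /tier_roots !size_drop size_takel size_zs ?tier_start_le //.
by do !split; lia.
Qed.

Let d01' : 0 <= d <= 1.
Proof. by have /andP[/ltW -> ->] := d01. Qed.

(** Tiers [r] and beyond contain [e r.-1] roots, so the coefficient in [tier_lead_neq0] is the one
    of [Psi] at that exponent. *)
Lemma tier_top_neq0 r : (0 < r <= size l)%N -> y (L - Lsum l r.-1)%N != 0.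
Proof.
move=> hr; have hs := size_tier_roots hr.
have := @tier_lead_neq0 R (take (tier_start r.-1) zs) (tier_roots r)
  (drop (tier_start r) zs) (a (tier_start r.-1)) d (tier_start_cmod_gt0 hr) d01'.
rewrite -(zs_tier hr) !hs size_zs => H.
have {H} : f`_(e r.-1) != 0.
  apply: H => //.
  - by move=> z; apply: large_roots.
  - by move=> z hz; case/andP: (tier_roots_cmod hr hz).
  - by move=> z; apply: small_roots.
rewrite coef_f coef_Psi_k ?leq_subr //; apply: contra => /eqP ->.
by rewrite rmorph0.
Qed.

Lemma tPsi_fac_close r eta t : (0 < r <= size l)%N -> 0 < eta <= 2^-1 ->
  (forall z, z \in tier_roots r -> eta * cmod z <= cmod (t - z)) ->
  cmod ((cpoly (tPsi_fac L k y l r)).[t] - \prod_(z <- tier_roots r) (t - z))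
    <= n.+1%:R * (4 * 8 ^+ n * d) * (2 * comp_const n / eta) ^+ n
       * cmod (\prod_(z <- tier_roots r) (t - z)).
Proof.
move=> hr heta ht; have hs := size_tier_roots hr.
have := @tier_close R (take (tier_start r.-1) zs) (tier_roots r)
  (drop (tier_start r) zs) (a (tier_start r.-1)) d (tier_start_cmod_gt0 hr) d01'.
rewrite -(zs_tier hr) !hs size_zs => H; apply: H => //.
- by move=> z; apply: large_roots.
- by move=> z hz; case/andP: (tier_roots_cmod hr hz).
- by move=> z; apply: small_roots.
- by move=> z hz; case/andP: (tier_roots_cmod hr hz).
- by rewrite /cpoly size_map_poly size_tPsi_fac_le.
- move=> i hi; rewrite !coef_f coef_Psi_k ?leq_subr // /cpoly coef_map /=.
  rewrite coef_tPsi_fac //; last by have := hs.2; lia.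
  by rewrite -rmorphM /= mulVKf // tier_top_neq0.
Qed.

Lemma tPsi_monic m : (m <= size l)%N ->
  (\prod_(1 <= r < m.+1) tPsi_fac L k y l r \is monic) /\
  size (\prod_(1 <= r < m.+1) tPsi_fac L k y l r) = (tier_start m).+1.
Proof.
elim: m => [|m IH] hm.
  by rewrite big_geq // monic1 size_poly1 tier_start0.
have [m1 m2] := IH (ltnW hm); have hm' : (0 < m.+1 <= size l)%N by [].
have [f1 f2] := tPsi_fac_monic kS compl hm' (tier_top_neq0 hm').
rewrite big_nat_recr //=; split; first by rewrite monicMr.
rewrite size_proper_mul; last by rewrite (monicP m1) mul1r lead_coef_eq0 monic_neq0.
rewrite m2 f2 /=; have := tier_startE hm; have := tier_startE (ltnW hm).
by have := tier_start_lt hm'; rewrite /=; lia.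
Qed.

Variables eta k2 : R.
Hypothesis etaP : 0 < eta <= 2^-1.
Hypothesis k2P : 0 <= k2 <= 2^-1.
Hypothesis dk2 :
  n.+1%:R * (4 * 8 ^+ n * d) * (2 * comp_const n / eta) ^+ n <= k2.

(** A root [w] of the factor is within [eta * cmod z] of some tier root [z]; otherwise
    [tPsi_fac_close] at [w] would bound a nonzero product by half of itself. Then [cmod w] and
    [cmod z] are comparable. *)
Lemma tPsi_fac_root_cmod r w : (0 < r <= size l)%N ->
  root (cpoly (tPsi_fac L k y l r)) w ->
  a (tier_start r.-1) <= 2 * comp_const n * cmod w /\
  cmod w <= 2 * a (tier_start r.-1).
Proof.
move=> hr rw; have [/andP[eta0 eta1] /andP[_ k21]] := (etaP, k2P).
have [z zT hz] : exists2 z, z \in tier_roots r & cmod (w - z) < eta * cmod z.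
  apply: contrapT => hn.
  have ht z : z \in tier_roots r -> eta * cmod z <= cmod (w - z).
    by move=> zT; rewrite leNgt; apply/negP => h; apply: hn; exists z.
  have := tPsi_fac_close hr etaP ht; rewrite (rootP rw) sub0r cmodN => h.
  have p0 : 0 < cmod (\prod_(z <- tier_roots r) (w - z)).
    rewrite cmod_gt0 prodf_seq_neq0; apply/allP => z zT /=.
    rewrite -cmod_gt0; apply: lt_le_trans (ht z zT).
    rewrite mulr_gt0 // cmod_gt0; apply: zs_neq0.
    by move: zT => /mem_drop /mem_take.
  have := le_trans h (ler_wpM2r (ltW p0) (le_trans dk2 k21)); lra.
have /andP[z1 z2] := tier_roots_cmod hr zT; have z0 := cmod_ge0 z.
have hz' : cmod (w - z) <= 2^-1 * cmod z.
  by apply: le_trans (ltW hz) _; rewrite ler_wpM2r.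
have w1 := cmod_split w z; have w2 := cmod_split z w; rewrite cmodB in w2.
split; last by lra.
have h : cmod z <= 2 * cmod w by lra.
have := ler_wpM2l (le_trans ler01 c1) h; lra.
Qed.

Lemma tPsi_close t :
  (forall z, z \in zs -> eta * cmod z <= cmod (t - z)) ->
  cmod ((cpoly (Psi L k y)).[t] - (cpoly (tPsi L k y l)).[t])
    <= 2 ^+ n * k2 * cmod (cpoly (Psi L k y)).[t].
Proof.
move=> ht; have /andP[k20 k21] := k2P; rewrite cmodB.
have -> : (cpoly (Psi L k y)).[t]
    = \prod_(1 <= r < (size l).+1) \prod_(z <- tier_roots r) (t - z).
  rewrite prod_tier_roots // tier_start_size -size_zs take_size.
  by rewrite horner_cpoly // Psi_monic.
have -> : (cpoly (tPsi L k y l)).[t]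
    = \prod_(1 <= r < (size l).+1) (cpoly (tPsi_fac L k y l r)).[t].
  by rewrite /cpoly /tPsi rmorph_prod horner_prod.
have := @cmod_prod_perturb R nat (index_iota 1 (size l).+1)
  (fun r => (cpoly (tPsi_fac L k y l r)).[t])
  (fun r => \prod_(z <- tier_roots r) (t - z)) k2 k20.
move=> H; apply: le_trans (H _) _.
  move=> r; rewrite mem_index_iota ltnS => hr.
  apply: le_trans (tPsi_fac_close hr etaP _) _.
    by move=> z zT; apply: ht; move: zT => /mem_drop /mem_take.
  by rewrite ler_wpM2r ?cmod_ge0.
rewrite ler_wpM2r ?cmod_ge0 // size_iota subn1 /=.
(* The number of tiers is at most [L], hence at most [n], which makes the bound independent of the
   composition. *)
apply: (@le_trans _ _ ((1 + k2) ^+ n - 1)).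
  rewrite lerD2r ler_weXn2l ?lerDl //.
  exact: leq_trans (size_comp_le compl) (leq_k kS (leqnn _)).
by apply: expr1D_sub1_le; rewrite k20; lra.
Qed.
End Regime.

(** * Choice of the constants and conclusion *)

Lemma tier_scale_exists (R : realType) (n : nat) (C1 eta kappa : R) :
  1 <= C1 -> 0 < eta <= 2^-1 -> 0 < kappa ->
  exists k2 d : R,
    [/\ 0 <= k2 <= 2^-1, 2 ^+ n * k2 <= Num.min kappa 2^-1,
        0 < d <= 1 /\ d <= kappa / 4, 4 ^+ n * d <= 2^-1 &
        n.+1%:R * (4 * 8 ^+ n * d) * (2 * C1 / eta) ^+ n <= k2].
Proof.
move=> C11 /andP[eta0 eta1] kap0; set kap := Num.min kappa 2^-1.
have kap_gt0 : 0 < kap by rewrite lt_min kap0 invr_gt0 ltr0n.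
have [kap_le kap_le2] : kap <= kappa /\ kap <= 2^-1.
  by rewrite !ge_min !lexx orbT.
have h2 : 1 <= 2 ^+ n :> R by rewrite exprn_ege1 // ler1n.
have h4 : 1 <= 4 ^+ n :> R by rewrite exprn_ege1 // ler1n.
have h8 : 8 ^+ n = 4 ^+ n * 2 ^+ n :> R.
  by rewrite -exprMn; congr (_ ^+ _); ring.
pose k2 := kap / 2 ^+ n.
have k20 : 0 < k2 by rewrite divr_gt0 //; lra.
have k21 : k2 <= kap by rewrite ler_pdivrMr ?ler_peMr //; lra.
pose B : R := n.+1%:R * (4 * 8 ^+ n) * (2 * C1 / eta) ^+ n.
have m1 u v : 1 <= u -> 1 <= v -> 1 <= u * v :> R.
  by move=> hu hv; rewrite -[1]mulr1 ler_pM.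
have r1 : 1 <= 2 * C1 / eta by rewrite ler_pdivlMr // mul1r; lra.
have B4 : 4 * 4 ^+ n <= B.
  have -> : B = 4 * 4 ^+ n * (n.+1%:R * (2 ^+ n * (2 * C1 / eta) ^+ n)).
    by rewrite /B h8; ring.
  rewrite ler_peMr ?mulr_ge0 ?exprn_ge0 //.
  by rewrite m1 ?ler1n // m1 // exprn_ege1.
have B0 : 0 < B by lra.
(* The bounds serve, in turn, the approximation error, the ratio between roots of successive tiers,
   and [d <= 1]. The condition [4 ^+ n * d <= 2^-1] follows from the first, since
   [4 * 4 ^+ n <= B]. *)
pose d := Num.min (Num.min (k2 / B) (kappa / 4)) 1.
have d0 : 0 < d by rewrite !lt_min !divr_gt0 // ltr01.
have dB : B * d <= k2 by rewrite mulrC -ler_pdivlMr // !ge_min lexx.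
exists k2, d; split.
- by rewrite (ltW k20) (le_trans k21).
- by rewrite mulrC divfK // gt_eqF //; lra.
- by rewrite d0 /d !ge_min !lexx !orbT.
- have h : 4 * 4 ^+ n * d <= B * d by rewrite ler_pM2r.
  have h' : 0 <= 4 ^+ n * d by rewrite mulr_ge0 ?exprn_ge0 // ltW.
  lra.
- apply: le_trans dB; rewrite le_eqVlt; apply/orP; left; apply/eqP.
  by rewrite /B; ring.
Qed.

(** Here [x'] and [x] stand for the leading moduli of two successive tiers, and [w] and [v] for
    moduli of roots of the corresponding factors. *)
Lemma scale_ratio_le (R : realType) (c d kappa x x' v w : R) :
  0 < c -> 0 <= d -> d <= kappa / 4 -> 0 <= w ->
  c * x <= d * x' -> x' <= 2 * c * w -> v <= 2 * x -> v <= kappa * w.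
Proof.
move=> c0 d0 dk w0 hx hx' hv.
have h1 : d * x' <= d * (2 * c * w) by rewrite ler_wpM2l.
have h2 : x <= 2 * d * w by rewrite -(ler_pM2l c0); lra.
have h3 : 4 * d * w <= kappa * w by rewrite ler_wpM2r //; lra.
lra.
Qed.

Theorem theorem9p2 (R : realType) (L : nat) (k : nat -> nat)
    (hL : (1 <= L)%N) (hk0 : k 0%N = 0%N)
    (hk : forall i j : nat, (i < j <= L)%N -> (k i < k j)%N)
    (C kappa : R) (hC : 1 <= C) (hkappa : 0 < kappa < 1) :
  exists K C' : R, [/\ 1 < K, 1 <= C' &
    forall (l : seq nat) (y : nat -> R),
      composition L l -> y 0%N != 0 -> y L = 1 ->
      tier_regime L k l C K (Psi L k y) ->
      [/\ (forall j : nat, (j <= size l)%N -> y (L - Lsum l j)%N != 0),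
          (forall (j : nat) (w w' : R[i]), (1 <= j <= size l)%N ->
             root (cpoly (tPsi_fac L k y l j)) w ->
             root (cpoly (tPsi_fac L k y l j)) w' ->
             `|w| <= C'%:C * `|w'|),
          (forall w : nat -> R[i],
             (forall j : nat, (1 <= j <= size l)%N ->
                root (cpoly (tPsi_fac L k y l j)) (w j)) ->
             forall j : nat, (1 <= j < size l)%N ->
               `|w j.+1| <= kappa%:C * `|w j|) &
          exists N : set R[i]^o,
            [/\ (forall z : R[i], root (cpoly (Psi L k y)) z -> N z),
                (forall z : R[i]^o, N z ->
                   let cell := connected_component N z in
                   [/\ is_open_ball cell,
                       (nb_roots_in (Psi L k y) cell <= L)%N &
                       forall m : nat, nb_roots_in (Psi L k y) cell = m ->
                         nb_roots_in (tPsi L k y l) cell = m]) &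
                (forall t : R[i], ~ N t ->
                   `|(cpoly (Psi L k y)).[t] - (cpoly (tPsi L k y l)).[t]|
                     <= kappa%:C * `|(cpoly (Psi L k y)).[t]|)]]].
Proof.
(* The order of choice gives uniformity: [e0] and [eta] depend on the exponents only, then [k2] and
   [d] on [C], [kappa] and [eta], all before [l] and [y]. *)
have [e0 [e0P clusterP]] := fewnomial_cluster R hk.
have [eta [etaP cellsP]] := cells_exist (k L) L e0P.
have /andP[kap0 _] := hkappa.
have C11 := comp_const_ge1 hC (k L).
have [k2 [d [k2P k2k [d01 dk] nd dk2]]] := tier_scale_exists (k L) C11 etaP kap0.
have d0 : 0 < d by case/andP: d01.
set C1 := comp_const C (k L) in C11 dk2.
pose K := C1 / d.
have dK : C1 = d * K by rewrite /K mulrC divfK // gt_eqF.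
have C10 : 0 < C1 by exact: lt_le_trans ltr01 C11.
(* In [4 * C1], a factor 2 comes from the upper bound for one root and [2 * C1] from the lower bound
   for the other, both in [tPsi_fac_root_cmod]. *)
exists K, (4 * C1); split.
- rewrite ltr_pdivlMr // mul1r; move: hkappa dk => /andP[_]; lra.
- by lra.
move=> l y compl y0 yL reg.
have rootsB r w (hr : (0 < r <= size l)%N) :=
  tPsi_fac_root_cmod hk compl hk0 yL reg y0 hC d01 nd dK etaP k2P dk2 hr (w := w).
split.
(* For [j = size l] the coefficient is [y 0]; for smaller [j] it is the top coefficient of tier
   [j.+1]. *)
- move=> j; rewrite leq_eqVlt => /orP[/eqP ->|hj].
    by rewrite (Lsum_size compl) subnn.
  exact: (tier_top_neq0 hk compl hk0 yL reg y0 hC d01 nd dK (r := j.+1)).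
- move=> j w w' hj hw hw'; rewrite !cmodE -rmorphM lecR.
  have [_ u1] := rootsB j w hj hw; have [u2 _] := rootsB j w' hj hw'.
  by apply: le_trans u1 _; rewrite -/C1 in u2; lra.
- move=> w hw j hj; rewrite !cmodE -rmorphM lecR.
  have /andP[j0 jl] := hj; have hj1 : (0 < j <= size l)%N by rewrite j0 ltnW.
  have hj2 : (0 < j.+1 <= size l)%N by [].
  have [_ u1] := rootsB _ _ hj2 (hw _ hj2).
  have [u2 _] := rootsB _ _ hj1 (hw _ hj1).
  apply: (scale_ratio_le C10 (ltW d0) dk (cmod_ge0 _) _ u2 u1).
  rewrite {1}dK -mulrA ler_pM2l //.
  exact: (tier_sep hk compl hk0 yL reg hj).
have mPsi := Psi_monic hk yL.
have [mt st] :=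
  tPsi_monic hk compl hk0 yL reg y0 hC d01 nd dK (leqnn (size l)).
rewrite (tier_start_size hk compl hk0) in st.
have estim t : (forall z, z \in croots (Psi L k y) -> eta * cmod z <= cmod (t - z)) ->
    cmod ((cpoly (Psi L k y)).[t] - (cpoly (tPsi L k y l)).[t])
      <= Num.min kappa 2^-1 * cmod (cpoly (Psi L k y)).[t].
  move=> ht; apply: le_trans
    (tPsi_close hk compl hk0 yL reg y0 hC d01 nd dK etaP k2P dk2 ht) _.
  by rewrite ler_wpM2r ?cmod_ge0.
have [|||||N [N1 N2 N3]] := cellsP (croots (Psi L k y)) (croots (tPsi L k y l)).
- exact: (size_zs hk yL).
- by rewrite size_croots // /tPsi st.
- by move=> z; apply: (zs_neq0 hk hk0 yL y0).
- move=> c c0; apply: (clusterP (fun j => (y j)%:C)) => //.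
  by rewrite -cpoly_monic // cpoly_Psi.
(* The cap [2^-1] in the minimum provides the error of at most one half that the root count
   requires. *)
- move=> t /estim; rewrite !horner_cpoly // => h.
  rewrite mulrC -ler_pdivlMr // mulrC; apply: le_trans h _.
  by rewrite ler_wpM2r ?cmod_ge0 // ge_min lexx orbT.
exists N; split.
- by move=> z; rewrite root_cpoly // => /N1.
- move=> z Nz cell; have [b1 b2 b3] := N2 z Nz; split=> // m <-.
  exact: esym b3.
- move=> t Nt; rewrite !cmodE -rmorphM lecR.
  apply: le_trans (estim t (N3 t Nt)) _.
  by rewrite ler_wpM2r ?cmod_ge0 // ge_min lexx.
Qed.
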